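(* Let $C>1$ be a constant and let $$K(q_1,q_2)=\frac{|q_1|^2}{C}-\mathrm{Li}_2(-|q_2|^2),\qquad (q_1,q_2)\in\mathbb C^2,$$ where $\mathrm{Li}_2(z)=-\int_0^z\log(1-u)\frac{du}{u}$ is the dilogarithm. Then $\frac{\partial^2K}{\partial q_1\partial\bar q_1}=\frac1C$ and $\frac{\partial^2K}{\partial q_2\partial\bar q_2}=\frac{1}{1+|q_2|^2}$, and the data $(I_+,I_-,F)$ determined by the generalized Kähler potential $K$ (as described in the context) define a generalized Kähler structure of symplectic type on $\mathbb R^4=\mathbb C^2$, with metric $$g=2\Big(\frac1C\,dq_1d\bar q_1+\frac{1}{1+|q_2|^2}\big(dq_2d\bar q_2+\frac iC\,\bar q_2\,dq_1dq_2-\frac iC\,q_2\,d\bar q_1d\bar q_2\big)\Big),$$ and this metric is complete.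
   Context: The structure determined by a generalized Kähler potential $K(q_1,q_2)$ here is the following. On $\mathbb C^4$ with holomorphic coordinates $(p_1,p_2,q_1,q_2)$ consider the holomorphic symplectic form $\Omega=dp_1\wedge dq_1+dp_2\wedge dq_2$ and the maps to $\mathbb C^2$ $$t(p_1,p_2,q_1,q_2)=(e^{p_1}q_2,\ q_1),\qquad s(p_1,p_2,q_1,q_2)=(q_2,\ q_1+p_2q_2).$$ (These are the target and source maps of a holomorphic symplectic groupoid integrating the Poisson structure $x\partial_x\wedge\partial_y$ on $\mathbb C^2$.) The brane is the submanifold $$\mathcal L=\{p_1=-i\,\partial K/\partial q_1,\ p_2=-i\,\partial K/\partial q_2\},$$ on which $(q_1,q_2)$ are used as coordinates; the restrictions $t|_{\mathcal L}$ and $s|_{\mathcal L}$ are diffeomorphisms onto $\mathbb C^2$. The complex structure $I_+$ (respectively $I_-$) on $\mathcal L\cong\mathbb C^2$ is the pullback of the standard complex structure of $\mathbb C^2$ by $t|_{\mathcal L}$ (respectively $s|_{\mathcal L}$), and $F=\Omega|_{\mathcal L}=i\partial\bar\partial K$ (with respect to the standard complex structure of the coordinates $q_1,q_2$). The associated metric and B-field are $$g=-\tfrac12F(I_++I_-),\qquad b=-\tfrac12F(I_+-I_-),$$ where $F$ is viewed as a map $T\to T^*$, $X\mapsto\iota_XF$. A generalized Kähler structure (in bihermitian form) is $(g,I_+,I_-,b)$ with $g$ a (positive-definite) Riemannian metric Hermitian for both complex structures $I_\pm$, such that, with $\omega_\pm=gI_\pm$ and $d^c_\pm=i(\bar\partial_\pm-\partial_\pm)$,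 one has $d^c_+\omega_++d^c_-\omega_-=0$, $dd^c_\pm\omega_\pm=0$ and $\pm d^c_\pm\omega_\pm=-db$. It is of symplectic type (in the gauge used here) when $g,b$ arise from a symplectic form $F$ by the displayed formulas, with $I_+-I_-=QF$ and $FI_++I_-^*F=0$, where $Q=\frac12[I_-,I_+]g^{-1}$. Products such as $dq_1dq_2$ are symmetric products, $\alpha\beta=\tfrac12(\alpha\otimes\beta+\beta\otimes\alpha)$. *)

(* Defs.v *)
From HB Require Import structures.
From mathcomp Require Import all_boot all_order all_algebra.
From mathcomp Require Import complex.
From mathcomp Require Import all_classical all_reals all_analysis.
Import Order.TTheory GRing.Theory Num.Theory.
Import numFieldNormedType.Exports.

Set Implicit Arguments.
Unset Strict Implicit.
Unset Printing Implicit Defensive.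

Local Open Scope classical_set_scope.
Local Open Scope ring_scope.
Local Open Scope complex_scope.

(* Tensors on R^(n+1) are written in the standard coordinates.  Points and
   tangent vectors are column vectors; an endomorphism field, or a map T -> T^*,
   is a matrix field acting on columns, a covector being the column of its
   components.  In particular the matrix A of X |-> iota_X F satisfies
   F(X, Y) = Y^T A X, and composition of maps is the matrix product. *)

Section Calculus.
Variables (R : realType) (n : nat).
Local Notation V := 'cV[R]_n.+1.
Local Notation VC := 'cV[R[i]]_n.+1.
Local Notation M := 'M[R]_n.+1.

Definition partial (j : 'I_n.+1) (f : V -> R) (x : V) : R :=
  'D_(delta_mx j 0) f x.

Fixpoint Ck (k : nat) (f : V -> R) : Prop :=
  continuous f /\
  if k is k'.+1 then
    (forall j x, derivable f x (delta_mx j 0)) /\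
    (forall j, Ck k' (partial j f))
  else True.

Definition smooth (f : V -> R) : Prop := forall k, Ck k f.

Definition smooth_map (f : V -> V) : Prop := forall i, smooth (fun x => f x i 0).

Definition smooth_mx (A : V -> M) : Prop := forall i j, smooth (fun x => A x i j).

Definition diffeo (f : V -> V) : Prop :=
  smooth_map f /\
  exists g : V -> V, [/\ cancel f g, cancel g f & smooth_map g].

Definition jac (f : V -> V) (x : V) : M :=
  \matrix_(i, j) partial j (fun y => f y i 0) x.

(* Pull-back by f of the (constant) endomorphism field J of the target. *)
Definition pullback_end (f : V -> V) (J : M) (x : V) : M :=
  invmx (jac f x) *m J *m jac f x.

Definition bil (A : M) (X Y : V) : R := (Y^T *m A *m X) 0 0.

Definition cpartial (j : 'I_n.+1) (f : V -> R[i]) (x : V) : R[i] :=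
  partial j (fun y => complex.Re (f y)) x +i*
  partial j (fun y => complex.Im (f y)) x.

(* df_x(w), extended C-linearly to complexified tangent vectors w. *)
Definition cdiff (f : V -> R[i]) (x : V) (w : VC) : R[i] :=
  \sum_j w j 0 * cpartial j f x.

Definition cvec (X : V) : VC := map_mx (real_complex R) X.

(* Complex differential k-forms, evaluated on k complexified tangent vectors. *)
Definition form (k : nat) := V -> ('I_k -> VC) -> R[i].

(* The invariant formula for d, on constant vector fields. *)
Definition extd k (a : form k) : form k.+1 := fun x v =>
  \sum_(i < k.+1)
    (-1) ^+ i * cdiff (fun y => a y (fun j => v (lift i j))) x (v i).

Definition proj10 (I : M) (w : VC) : VC :=
  2^-1 *: (w - 'i *: (map_mx (real_complex R) I *m w)).
Definition proj01 (I : M) (w : VC) : VC :=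
  2^-1 *: (w + 'i *: (map_mx (real_complex R) I *m w)).

(* The component of type (p, k - p) of a k-form with respect to I. *)
Definition type_part (I : V -> M) (p : nat) k (a : form k) : form k := fun x v =>
  \sum_(S : {set 'I_k} | #|S| == p)
    a x (fun i => if i \in S then proj10 (I x) (v i) else proj01 (I x) (v i)).

Definition del (I : V -> M) k (a : form k) : form k.+1 := fun x v =>
  \sum_(p < k.+1) type_part I p.+1 (extd (type_part I p a)) x v.

Definition delbar (I : V -> M) k (a : form k) : form k.+1 := fun x v =>
  \sum_(p < k.+1) type_part I p (extd (type_part I p a)) x v.

Definition dc (I : V -> M) k (a : form k) : form k.+1 := fun x v =>
  'i * (delbar I a x v - del I a x v).

(* The C-bilinear extension of (X, Y) |-> Y^T A X. *)
Definition form2 (A : V -> M) : form 2 := fun x v =>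
  ((v 1)^T *m map_mx (real_complex R) (A x) *m v 0) 0 0.

Definition skew (A : V -> M) : Prop := forall x, (A x)^T = - A x.

(* Derivative of a matrix field along a vector. *)
Definition dmx (A : V -> M) (x X : V) : M :=
  \matrix_(i, j) \sum_l X l 0 * partial l (fun y => A y i j) x.

(* N_I(X, Y) = [IX, IY] - I[IX, Y] - I[X, IY] - [X, Y] for constant vector
   fields X, Y, with [U, W] = D_U W - D_W U. *)
Definition nijenhuis (I : V -> M) (x X Y : V) : V :=
  (dmx I x (I x *m X) *m Y - dmx I x (I x *m Y) *m X)
  + I x *m (dmx I x Y *m X) - I x *m (dmx I x X *m Y).

Record complex_structure (I : V -> M) : Prop := ComplexStructure {
  cs_smooth : smooth_mx I;
  cs_square : forall x, I x *m I x = - 1%:M;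
  cs_integrable : forall x X Y, nijenhuis I x X Y = 0 }.

Record riemannian_metric (g : V -> M) : Prop := RiemannianMetric {
  rm_smooth : smooth_mx g;
  rm_sym : forall x, (g x)^T = g x;
  rm_pos : forall x X, X != 0 -> 0 < bil (g x) X X }.

Definition hermitian (g I : V -> M) : Prop :=
  forall x, (I x)^T *m g x *m I x = g x.

Record symplectic_form (F : V -> M) : Prop := SymplecticForm {
  sf_smooth : smooth_mx F;
  sf_skew : skew F;
  sf_nondeg : forall x, F x \in unitmx;
  sf_closed : forall x v, extd (form2 F) x v = 0 }.

Definition fundamental_form (g I : V -> M) : form 2 :=
  form2 (fun x => g x *m I x).

Record generalized_kahler (g Ip Im b : V -> M) : Prop := GeneralizedKahler {
  gk_metric : riemannian_metric g;
  gk_csp : complex_structure Ip;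
  gk_csm : complex_structure Im;
  gk_hermp : hermitian g Ip;
  gk_hermm : hermitian g Im;
  gk_bsmooth : smooth_mx b;
  gk_bskew : skew b;
  gk_sum : forall x v, dc Ip (fundamental_form g Ip) x v
                     + dc Im (fundamental_form g Im) x v = 0;
  gk_ddcp : forall x v, extd (dc Ip (fundamental_form g Ip)) x v = 0;
  gk_ddcm : forall x v, extd (dc Im (fundamental_form g Im)) x v = 0;
  gk_dbp : forall x v,
    dc Ip (fundamental_form g Ip) x v = - extd (form2 b) x v;
  gk_dbm : forall x v,
    - dc Im (fundamental_form g Im) x v = - extd (form2 b) x v }.

Definition metric_of (Ip Im F : V -> M) (x : V) : M :=
  - 2^-1 *: (F x *m (Ip x + Im x)).

Definition bfield_of (Ip Im F : V -> M) (x : V) : M :=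
  - 2^-1 *: (F x *m (Ip x - Im x)).

Definition Qmx (g Ip Im : V -> M) (x : V) : M :=
  2^-1 *: ((Im x *m Ip x - Ip x *m Im x) *m invmx (g x)).

Record gk_symplectic_type (Ip Im F : V -> M) : Prop := GKSymplecticType {
  gks_kahler :
    generalized_kahler (metric_of Ip Im F) Ip Im (bfield_of Ip Im F);
  gks_symplectic : symplectic_form F;
  gks_diff : forall x, Ip x - Im x = Qmx (metric_of Ip Im F) Ip Im x *m F x;
  gks_compat : forall x, F x *m Ip x + (Im x)^T *m F x = 0 }.

Definition C1_curve (c : R -> V) : Prop :=
  (forall s, derivable c s 1) /\ continuous (derive1 c).

Definition curve_length (g : V -> M) (c : R -> V) : R :=
  \int[lebesgue_measure]_(s in `[0, 1])
    Num.sqrt (bil (g (c s)) (derive1 c s) (derive1 c s)).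

(* l is the g-length of a piecewise C^1 curve from x to y; the pieces are
   parametrised by [0, 1] and (harmlessly) extended to R. *)
Inductive joined_by_length (g : V -> M) : V -> V -> R -> Prop :=
| joined_nil x : joined_by_length g x x 0
| joined_cons c y l : C1_curve c -> joined_by_length g (c 1) y l ->
    joined_by_length g (c 0) y (curve_length g c + l).

Definition riemannian_dist (g : V -> M) (x y : V) : R :=
  inf [set l | joined_by_length g x y l].

Definition complete_metric (g : V -> M) : Prop :=
  forall u : nat -> V,
    (forall e, 0 < e -> exists N, forall m k, (N <= m)%N -> (N <= k)%N ->
       riemannian_dist g (u m) (u k) < e) ->
    exists x, forall e, 0 < e -> exists N, forall m, (N <= m)%N ->
       riemannian_dist g (u m) x < e.

End Calculus.

(* C^2 is identified with R^4 by (x1, y1, x2, y2), q_j = x_j + i y_j. *)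
Section Brane.
Variable R : realType.
Local Notation V := 'cV[R]_4.
Local Notation C := R[i].

Definition q1 (x : V) : C := x 0 0 +i* x 1 0.
Definition q2 (x : V) : C := x 2 0 +i* x 3 0.

Definition ofC2 (z : C * C) : V :=
  \col_i [:: complex.Re z.1; complex.Im z.1; complex.Re z.2; complex.Im z.2]`_i.

(* The standard complex structure: multiplication by i on C^2. *)
Definition J0 : 'M[R]_4 :=
  \matrix_(i, j) ofC2 ('i * q1 (delta_mx j 0), 'i * q2 (delta_mx j 0)) i 0.

(* d/dz and d/d\bar z, for z = x_j + i x_k. *)
Definition wirt (j k : 'I_4) (f : V -> C) (x : V) : C :=
  2^-1 * (cpartial j f x - 'i * cpartial k f x).
Definition wirtbar (j k : 'I_4) (f : V -> C) (x : V) : C :=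
  2^-1 * (cpartial j f x + 'i * cpartial k f x).

Definition d_q1 : (V -> C) -> V -> C := wirt 0 1.
Definition d_q2 : (V -> C) -> V -> C := wirt 2 3.
Definition d_q1bar : (V -> C) -> V -> C := wirtbar 0 1.
Definition d_q2bar : (V -> C) -> V -> C := wirtbar 2 3.

Definition cfun (K : V -> R) (x : V) : C := (K x)%:C.

Definition cexp (z : C) : C :=
  (expR (complex.Re z) * cos (complex.Im z)) +i*
  (expR (complex.Re z) * sin (complex.Im z)).

(* Points of C^4, in the coordinates p1, p2, q1, q2. *)
Record C4 : Type := MkC4 { c_p1 : C; c_p2 : C; c_q1 : C; c_q2 : C }.

Definition Omega (u w : C4) : C :=
  (c_p1 u * c_q1 w - c_p1 w * c_q1 u) + (c_p2 u * c_q2 w - c_p2 w * c_q2 u).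

Definition target (m : C4) : C * C := (cexp (c_p1 m) * c_q2 m, c_q1 m).
Definition source (m : C4) : C * C := (c_q2 m, c_q1 m + c_p2 m * c_q2 m).

(* The brane L, parametrised by (q1, q2). *)
Definition brane (K : V -> R) (x : V) : C4 :=
  MkC4 (- 'i * d_q1 (cfun K) x) (- 'i * d_q2 (cfun K) x) (q1 x) (q2 x).

Definition dbrane (K : V -> R) (x X : V) : C4 :=
  MkC4 (cdiff (fun y => c_p1 (brane K y)) x (cvec X))
       (cdiff (fun y => c_p2 (brane K y)) x (cvec X))
       (cdiff (fun y => c_q1 (brane K y)) x (cvec X))
       (cdiff (fun y => c_q2 (brane K y)) x (cvec X)).

Definition tL (K : V -> R) (x : V) : V := ofC2 (target (brane K x)).
Definition sL (K : V -> R) (x : V) : V := ofC2 (source (brane K x)).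

Definition Iplus (K : V -> R) : V -> 'M[R]_4 := pullback_end (tL K) J0.
Definition Iminus (K : V -> R) : V -> 'M[R]_4 := pullback_end (sL K) J0.

Definition OmegaL (K : V -> R) (x X Y : V) : C :=
  Omega (dbrane K x X) (dbrane K x Y).

(* The matrix of X |-> iota_X (Omega|_L); its entry (i, j) is F(e_j, e_i).
   Taking real parts loses nothing when Omega|_L is real. *)
Definition FL (K : V -> R) (x : V) : 'M[R]_4 :=
  \matrix_(i, j) complex.Re (OmegaL K x (delta_mx j 0) (delta_mx i 0)).

Definition dq1 (X : V) : C := q1 X.
Definition dq2 (X : V) : C := q2 X.
Definition dq1bar (X : V) : C := (q1 X)^*.
Definition dq2bar (X : V) : C := (q2 X)^*.

Definition wedge (a b : V -> C) (X Y : V) : C := a X * b Y - a Y * b X.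

Definition symprod (a b : V -> C) (X Y : V) : C :=
  2^-1 * (a X * b Y + b X * a Y).

(* i \partial \bar\partial K for the standard complex structure. *)
Definition i_ddbar (K : V -> R) (x X Y : V) : C :=
  'i * (d_q1 (d_q1bar (cfun K)) x * wedge dq1 dq1bar X Y
      + d_q1 (d_q2bar (cfun K)) x * wedge dq1 dq2bar X Y
      + d_q2 (d_q1bar (cfun K)) x * wedge dq2 dq1bar X Y
      + d_q2 (d_q2bar (cfun K)) x * wedge dq2 dq2bar X Y).

(* Oriented integral from a to b. *)
Definition oint (a b : R) (f : R -> R) : R :=
  if a <= b then \int[lebesgue_measure]_(u in `[a, b]) f u
  else - \int[lebesgue_measure]_(u in `[b, a]) f u.

(* The dilogarithm at a real argument z < 1. *)
Definition Li2 (z : R) : R := - oint 0 z (fun u => ln (1 - u) / u).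

(* |q|^2 as a real number. *)
Definition nsq (z : C) : R := complex.Re z ^+ 2 + complex.Im z ^+ 2.

Definition Kpot (c : R) (x : V) : R := nsq (q1 x) / c - Li2 (- nsq (q2 x)).

Definition metric_formula (c : R) (x X Y : V) : C :=
  2 * ((c^-1)%:C * symprod dq1 dq1bar X Y
     + ((1 + nsq (q2 x))^-1)%:C *
         (symprod dq2 dq2bar X Y
          + 'i / c%:C * (q2 x)^* * symprod dq1 dq2 X Y
          - 'i / c%:C * q2 x * symprod dq1bar dq2bar X Y)).

End Brane.

(* Main.v *)
(** The function [-Li_2(-r)] has derivative [ln (1 + r) / r], which is smooth across
    [r = 0] because it is the integral of [1 / (1 + r t)] over [0 <= t <= 1].  This
    gives [t = (exp (-i q1bar / c) q2, q1)] and [s = (q2, q1 - i ln (1 + |q2|^2))]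
    on the brane.  Writing [h = 1 / (1 + |q2|^2)], the forms [dq1] and
    [dq2 - (i q2 / c) dq1bar] are of type (1,0) for [I_+], while [dq2] and
    [dq1 - i h d|q2|^2] are of type (1,0) for [I_-].  All the tensors depend on q2
    only, and [db = (4 h^2 / c) dx_1 dx_2 dy_2] has one component, so that the
    torsion conditions and [dd^c omega = 0] are finite computations.

    Positivity follows from completing the square and [h |q2|^2 < 1 < c].  The same
    identity bounds the differentials of [q1], [ln (1 + |q2|^2)] and
    [q2 / sqrt (1 + |q2|^2)] by a multiple of the metric norm.  Hence a Cauchy
    sequence for g has convergent coordinates, and it converges for g because
    [g <= 16 (|dx_1| + |dy_1| + |dx_2| + |dy_2|)^2]. *)

Require Import Defs.
From mathcomp Require Import all_boot all_order all_algebra.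
From mathcomp Require Import complex.
From mathcomp Require Import all_classical all_reals all_analysis.
From mathcomp Require Import ring lra.
Import Order.TTheory GRing.Theory Num.Theory.
Import numFieldNormedType.Exports.
Local Open Scope ring_scope.
Local Open Scope complex_scope.
Set Implicit Arguments.
Unset Strict Implicit.
Unset Printing Implicit Defensive.

(** * Smooth functions *)

(** The integrand of [Li2] divides by the integration variable, so formal differentiation of
    [ln (1 + r) / r] says nothing at [r = 0], that is along [q2 = 0]. Derivatives therefore pass
    through the integrals [lnq n], shown differentiable for [r > -1/2], and the relation
    [lnq 0 r + r * lnq 1 r = 1 / (1 + r)] removes the integrals from every tensor. The operator d^c
    is given by sums of type projections. For a (1,1)-form w they reduce to a combination of values
    of dw on vectors [v_i] and [I v_i]; each torsion identity is then polynomial in [x], [h] and the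
    components of the vectors, modulo [h |q2|^2 = 1 - h]. The distance is an infimum over piecewise
    C^1 curves, and completeness uses no geodesics: a function whose differential is bounded by the
    metric norm sends Cauchy sequences to Cauchy sequences. Since [h] decays at infinity, dx_2 and
    dy_2 have no such bound; this is why q2 is recovered from a logarithm and a rescaling. *)

Section ContinuousOps.
Variables (R : realType) (T : topologicalType).
Implicit Types f g : T -> R.

Lemma continuous_add f g : continuous f -> continuous g ->
  continuous (fun x => f x + g x).
Proof. by move=> cf cg x; exact: (continuousD (cf x) (cg x)). Qed.

Lemma continuous_mul f g : continuous f -> continuous g ->
  continuous (fun x => f x * g x).
Proof. by move=> cf cg x; exact: (continuousM (cf x) (cg x)). Qed.

Lemma continuous_sum (I : Type) (s : seq I) (F : I -> T -> R) :
  (forall i, continuous (F i)) -> continuous (fun x => \sum_(i <- s) F i x).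
Proof.
move=> cF; elim: s => [|i s IH].
  have -> : (fun x => \sum_(i <- [::]) F i x) = fun=> 0.
    by apply/funext => x; rewrite big_nil.
  exact: cst_continuous.
have -> : (fun x => \sum_(j <- i :: s) F j x) = fun x => F i x + \sum_(j <- s) F j x.
  by apply/funext => x; rewrite big_cons.
exact: continuous_add.
Qed.

End ContinuousOps.

(** * Calculus rules for directional derivatives *)

Section DirectionalDerivatives.
Local Open Scope classical_set_scope.
Variables (R : realType) (V : normedModType R).
Implicit Types (f g : V -> R) (x v : V).

Lemma is_derive_add f g x v (df dg : R) : is_derive x v f df ->
  is_derive x v g dg -> is_derive x v (fun y => f y + g y) (df + dg).
Proof. exact: is_deriveD. Qed.

Lemma is_derive_opp f x v (df : R) : is_derive x v f df ->
  is_derive x v (fun y => - f y) (- df).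
Proof. exact: is_deriveN. Qed.

Lemma is_derive_mul f g x v (df dg : R) : is_derive x v f df ->
  is_derive x v g dg -> is_derive x v (fun y => f y * g y) (df * g x + f x * dg).
Proof.
move=> Df Dg; apply: (is_derive_eq (@is_deriveM _ _ f g _ _ _ _ Df Dg)).
by rewrite addrC; congr (_ + _); exact: mulrC.
Qed.

(** Only a directional derivative of [f] is assumed, so [f] is restricted to the line [h *: v + x]
    and the one-variable chain rule is applied at [h = 0]. *)
Lemma is_derive_comp (phi : R -> R) f x v (d df : R) : is_derive (f x) 1 phi d ->
  is_derive x v f df -> is_derive x v (fun y => phi (f y)) (d * df).
Proof.
move=> dphi Df.
have f0 : (fun h : R => f (h *: v + x)) 0 = f x by rewrite scale0r add0r.
have D1 : is_derive (0 : R) (1 : R) (fun h : R => f (h *: v + x)) df.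
  split; first by have [/derivable1P] := Df.
  have <- : 'D_v f x = df by exact: derive_val.
  rewrite /derive; set g1 := fun h => h^-1 *: _; set g2 := fun h => h^-1 *: _.
  suff -> : g1 = g2 by [].
  apply/funext => h; rewrite /g1 /g2 /=.
  by rewrite addr0 scale0r add0r scaler1.
rewrite -f0 in dphi.
have := is_derive1_comp dphi D1 => D2.
split; first by apply/derivable1P; case: D2.
have <- : 'D_1 (phi \o (fun h : R => f (h *: v + x))) 0 = d * df.
  exact: derive_val.
rewrite /derive; set g1 := fun h => h^-1 *: _; set g2 := fun h => h^-1 *: _.
  suff -> : g1 = g2 by [].
  apply/funext => h; rewrite /g1 /g2 /=.
by rewrite addr0 scale0r add0r scaler1.
Qed.

Lemma is_derive_exp n f x v (df : R) : is_derive x v f df ->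
  is_derive x v (fun y => f y ^+ n) (n%:R * f x ^+ n.-1 * df).
Proof.
move=> Df; have -> : (fun y => f y ^+ n) = f ^+ n.
  by apply/funext => y; rewrite exprfctE.
exact: is_deriveX.
Qed.

Lemma is_derive_inv f x v (df : R) : f x != 0 -> is_derive x v f df ->
  is_derive x v (fun y => (f y)^-1) (- df * (f x)^-1 ^+ 2).
Proof.
move=> fx0 Df.
have D1 : is_derive (f x) 1 (fun u : R => u^-1) (- (f x)^-1 ^+ 2).
  apply: (is_derive_eq (is_deriveV fx0 (is_derive_id _ _))).
  by rewrite scaler1 exprVn.
have := is_derive_comp D1 Df => /= D.
by apply: (is_derive_eq D); rewrite !mulNr mulrC.
Qed.

Lemma is_derive_lnf f x v (df : R) : 0 < f x -> is_derive x v f df ->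
  is_derive x v (fun y => ln (f y)) (df / f x).
Proof.
move=> fx0 Df; have := is_derive_comp (is_derive1_ln fx0) Df => D.
by apply: (is_derive_eq D); rewrite mulrC.
Qed.

End DirectionalDerivatives.

Section Smooth.
Variables (R : realType) (n : nat).
Local Notation V := 'cV[R]_n.+1.
Implicit Types (f g : V -> R).

Lemma coord_continuous i : continuous (fun x : V => x i 0).
Proof. exact: coord_continuous. Qed.

Lemma is_derive_coord (x v : V) i : is_derive x v (fun y : V => y i 0) (v i 0).
Proof.
have [D E] : is_derive x v (@id V) v by exact: is_derive_id.
split; first by move/derivable_mxP: D => /(_ i 0).
by move: (derive_mx D) => /(congr1 (fun M : V => M i 0)); rewrite E mxE.
Qed.

Definition has_partials f (Df : 'I_n.+1 -> V -> R) : Prop :=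
  forall j x, is_derive x (delta_mx j 0) f (Df j x).

Lemma partialE f Df j : has_partials f Df -> partial j f = Df j.
Proof. by move=> df; apply/funext => x; have Dx := df j x; exact: derive_val. Qed.

Lemma CkW k f : Ck k.+1 f -> Ck k f.
Proof.
elim: k f => [|k IH] f; first by case.
by move=> [cf [df pf]]; split=> //; split=> // j; exact/IH/pf.
Qed.

Lemma Ck_derive k f (Df : 'I_n.+1 -> V -> R) : continuous f ->
  has_partials f Df ->
  (forall j, Ck k (Df j)) -> Ck k.+1 f.
Proof.
move=> cf df Ckf; split=> //; split=> [j x|j]; first by have [] := df j x.
by rewrite (partialE _ df).
Qed.

Lemma smooth_continuous f : smooth f -> continuous f.
Proof. by move=> /(_ 0%N)[]. Qed.
Arguments smooth_continuous f sf x : clear implicits.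

Lemma smooth_partial f j : smooth f -> smooth (partial j f).
Proof. by move=> sf k; case: (sf k.+1) => _ [_]; exact. Qed.

Lemma smooth_is_derive f j x : smooth f ->
  is_derive x (delta_mx j 0) f (partial j f x).
Proof. by move=> /(_ 1%N)[_ [df _]]; exact: derivableP. Qed.

Lemma smooth_derive f (Df : 'I_n.+1 -> V -> R) : continuous f ->
  has_partials f Df ->
  (forall j, smooth (Df j)) -> smooth f.
Proof.
by move=> cf df sf [|k]; [split|apply: Ck_derive => // j; exact: sf].
Qed.

Lemma Ck_cst k (a : R) : Ck k (fun _ : V => a).
Proof.
elim: k a => [|k IH] a; first by split=> //; exact: cst_continuous.
apply: (Ck_derive (Df := fun _ _ => 0)) => //.
  exact: cst_continuous.
by move=> j x; exact: is_derive_cst.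
Qed.

Lemma smooth_cst (a : R) : smooth (fun _ : V => a).
Proof. by move=> k; exact: Ck_cst. Qed.

Lemma smooth_coord i : smooth (fun x : V => x i 0).
Proof.
apply: (smooth_derive (Df := fun j _ => (delta_mx j 0 : V) i 0)).
- exact: coord_continuous.
- by move=> j x; exact: is_derive_coord.
- by move=> j; exact: smooth_cst.
Qed.

Lemma CkD k f g : Ck k f -> Ck k g -> Ck k (fun x => f x + g x).
Proof.
elim: k f g => [|k IH] f g [cf];
  first by move=> _ [cg _]; split=> //; exact: continuous_add.
move=> [df pf] [cg [dg pg]].
apply: (Ck_derive (Df := fun j x => partial j f x + partial j g x)).
- exact: continuous_add.
- by move=> j x; apply: is_derive_add; exact: derivableP.
- by move=> j; apply: IH; [exact: pf|exact: pg].
Qed.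

Lemma CkM k f g : Ck k f -> Ck k g -> Ck k (fun x => f x * g x).
Proof.
elim: k f g => [|k IH] f g [cf];
  first by move=> _ [cg _]; split=> //; exact: continuous_mul.
move=> [df pf] [cg [dg pg]].
apply: (Ck_derive (Df := fun j x => partial j f x * g x + f x * partial j g x)).
- exact: continuous_mul.
- by move=> j x; apply: is_derive_mul; exact: derivableP.
- move=> j; apply: CkD; apply: IH; by [exact: pf|exact: pg|exact: CkW].
Qed.

Lemma smoothD f g : smooth f -> smooth g -> smooth (fun x => f x + g x).
Proof. by move=> sf sg k; exact: CkD. Qed.

Lemma smoothM f g : smooth f -> smooth g -> smooth (fun x => f x * g x).
Proof. by move=> sf sg k; exact: CkM. Qed.

Lemma smoothN f : smooth f -> smooth (fun x => - f x).
Proof.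
move=> sf; have -> : (fun x => - f x) = (fun x => -1 * f x).
  by apply/funext => x; rewrite mulN1r.
by apply: smoothM => //; exact: smooth_cst.
Qed.

Lemma smoothX m f : smooth f -> smooth (fun x => f x ^+ m).
Proof.
move=> sf; elim: m => [|m IH].
  by under eq_fun do rewrite expr0; exact: smooth_cst.
by under eq_fun do rewrite exprS; exact: smoothM.
Qed.

(** The partial derivatives of [1 / f] are products of [1 / f] with partial derivatives of [f], so
    the induction on the order closes on itself. *)
Lemma smoothV f : (forall x, f x != 0) -> smooth f ->
  smooth (fun x => (f x)^-1).
Proof.
move=> f0 sf.
have cf : continuous (fun x => (f x)^-1).
  by move=> x; exact: (@continuousV _ _ f x (f0 x) (smooth_continuous _ sf x)).
elim=> [|k IH]; first by split.
apply: (Ck_derive (Df := fun j x => - partial j f x * (f x)^-1 ^+ 2)) => //.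
  by move=> j x; apply: is_derive_inv => //; exact: smooth_is_derive.
move=> j; apply: CkM; first exact/smoothN/smooth_partial.
exact: CkM.
Qed.

(* The successive derivatives of [phi 0] are only required on the range of f. *)
Lemma smooth_comp (phi : nat -> R -> R) f :
  (forall m x, is_derive (f x) 1 (phi m) (phi m.+1 (f x))) -> smooth f ->
  forall m, smooth (fun x => phi m (f x)).
Proof.
move=> dphi sf m k.
have cphi l : continuous (fun x => phi l (f x)).
  move=> x; apply: continuous_comp; first exact: (smooth_continuous _ sf).
  by apply: differentiable_continuous; apply/derivable1_diffP/ex_derive.
elim: k m => [|k IH] m; first by split.
apply: (Ck_derive (Df := fun j x => phi m.+1 (f x) * partial j f x)) => //.
  by move=> j x; apply: is_derive_comp => //; exact: smooth_is_derive.
by move=> j; apply: CkM => //; exact: smooth_partial.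
Qed.

Lemma smooth_expR f : smooth f -> smooth (fun x => expR (f x)).
Proof.
by move=> sf; apply: (@smooth_comp (fun _ => expR)) => // _ x; exact: is_derive_expR.
Qed.

(** Each of the two functions occurs in the derivative of the other, hence the simultaneous
    induction. *)
Lemma smooth_trig f : smooth f ->
  smooth (fun x => cos (f x)) /\ smooth (fun x => sin (f x)).
Proof.
move=> sf; suff H k : Ck k (fun x => cos (f x)) /\ Ck k (fun x => sin (f x)).
  by split=> k; case: (H k).
have cc : continuous (fun x => cos (f x)).
  by move=> x; apply: continuous_comp; [exact: smooth_continuous|exact: continuous_cos].
have cs : continuous (fun x => sin (f x)).
  by move=> x; apply: continuous_comp; [exact: smooth_continuous|exact: continuous_sin].
elim: k => [|k [IHc IHs]]; first by split; split.
split.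
- apply: (Ck_derive (Df := fun j x => - sin (f x) * partial j f x)) => //.
    move=> j x; apply: is_derive_comp (is_derive_cos _) _.
    exact: smooth_is_derive.
  move=> j; apply: CkM; last exact: smooth_partial.
  under eq_fun do rewrite -mulN1r.
  by apply: CkM => //; exact: Ck_cst.
- apply: (Ck_derive (Df := fun j x => cos (f x) * partial j f x)) => //.
    move=> j x; apply: is_derive_comp (is_derive_sin _) _.
    exact: smooth_is_derive.
  by move=> j; apply: CkM => //; exact: smooth_partial.
Qed.

Lemma smooth_ln f : (forall x, 0 < f x) -> smooth f ->
  smooth (fun x => ln (f x)).
Proof.
move=> f0 sf; apply: (smooth_derive (Df := fun j x => partial j f x / f x)).
- by move=> x; apply: continuous_comp; [exact: smooth_continuous|exact: continuous_ln].
- by move=> j x; apply: is_derive_lnf => //; exact: smooth_is_derive.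
- move=> j; apply: smoothM; first exact: smooth_partial.
  by apply: smoothV => // x; rewrite gt_eqF.
Qed.

End Smooth.

(** * The function ln (1 + r) / r and the dilogarithm *)

Section IntervalIntegral.
Local Open Scope classical_set_scope.
Variable R : realType.
Local Notation mu := (@lebesgue_measure R).
Implicit Types (f F : R -> R) (a b : R).

Lemma continuous_within_itv f a b :
  (forall x, x \in `[a, b]%R -> {for x, continuous f}) ->
  {within `[a, b], continuous f}.
Proof.
move=> cf; apply: continuous_in_subspaceT => x; rewrite inE => xab.
exact: cf.
Qed.

Lemma continuous_integrable f a b :
  (forall x, x \in `[a, b]%R -> {for x, continuous f}) ->
  mu.-integrable `[a, b] (EFin \o f).
Proof.
move=> cf; apply: continuous_compact_integrable; first exact: segment_compact.
exact: continuous_within_itv.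
Qed.

Lemma is_derive_continuous f x (d : R) : is_derive x (1 : R) f d ->
  {for x, continuous f}.
Proof. by move=> [df _]; apply: differentiable_continuous; apply/derivable1_diffP. Qed.

Lemma is_derive_affine a b x : is_derive x (1 : R) (fun s : R => a + b * s) b.
Proof.
have D := is_derive_add (is_derive_cst a x (1 : R))
  (is_derive_mul (is_derive_cst b x (1 : R)) (is_derive_id x (1 : R))).
by apply: (is_derive_eq D); rewrite add0r mul0r mulr1 add0r.
Qed.

(** Differentiability of [F] at the endpoints as well supplies the one-sided limits that the
    fundamental theorem asks for. *)
Lemma Rintegral_derive f F a b : a < b ->
  (forall x, x \in `[a, b]%R -> {for x, continuous f}) ->
  (forall x, x \in `[a, b]%R -> is_derive x (1 : R) F (f x)) ->
  \int[mu]_(x in `[a, b]) f x = F b - F a.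
Proof.
move=> ab cf dF; rewrite /Rintegral (@continuous_FTC2 _ f F) //.
- exact: continuous_within_itv.
- have cF x : x \in `[a, b]%R -> {for x, continuous F}.
    by move=> /dF; exact: is_derive_continuous.
  split=> [x xab||].
  + by have [] := dF x (subset_itv_oo_cc xab).
  + by apply: cvg_at_right_filter; apply: cF; rewrite in_itv/= lexx ltW.
  + by apply: cvg_at_left_filter; apply: cF; rewrite in_itv/= lexx ltW.
- move=> x xab; have Dx := dF x (subset_itv_oo_cc xab).
  by rewrite derive1E; exact: derive_val.
Qed.

End IntervalIntegral.

Section Dilogarithm.
Local Open Scope classical_set_scope.
Variable R : realType.
Local Notation mu := (@lebesgue_measure R).

(* The integrand of the n-th derivative of [ln (1 + r) / r], which is the
   integral of [1 / (1 + r t)] over [0 <= t <= 1]. *)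
Definition lnq_kernel n (r t : R) : R :=
  (-1) ^+ n * n`!%:R * t ^+ n * (1 + r * t)^-1 ^+ n.+1.

Definition lnq n (r : R) : R := \int[mu]_(t in `[0, 1]) lnq_kernel n r t.

(** The threshold -1/2 leaves room on both sides of [r = 0] and keeps the denominator [1 + r * t]
    uniformly away from 0. *)
Lemma half_le_1D (r t : R) : - 2^-1 < r -> t \in `[0, 1]%R -> 2^-1 <= 1 + r * t.
Proof. by move=> r0; rewrite in_itv/= => /andP[t0 t1]; nra. Qed.

Lemma lnq_kernel_derive n (r t : R) : 1 + r * t != 0 ->
  is_derive r (1 : R) (fun s => lnq_kernel n s t) (lnq_kernel n.+1 r t).
Proof.
move=> rt0.
have D1 : is_derive r (1 : R) (fun s : R => 1 + s * t) t.
  by under eq_fun do rewrite mulrC; exact: is_derive_affine.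
have D2 := is_derive_inv (f := fun s : R => 1 + s * t) rt0 D1.
have D3 := is_derive_exp n.+1 D2.
have D4 := is_derive_mul (is_derive_cst ((-1) ^+ n * n`!%:R * t ^+ n) r 1) D3.
apply: (is_derive_eq D4).
rewrite mul0r add0r /= /lnq_kernel factS natrM.
by rewrite !exprS; ring.
Qed.

Lemma lnq_kernel_continuous n (r t : R) : 1 + r * t != 0 ->
  {for t, continuous (lnq_kernel n r)}.
Proof.
move=> rt0.
have D2 := is_derive_inv (f := fun s : R => 1 + r * s) rt0 (is_derive_affine 1 r t).
have D3 := is_derive_exp n.+1 D2.
have D5 := is_derive_exp n (is_derive_id t (1 : R)).
have D4 := is_derive_mul
  (is_derive_mul (is_derive_cst ((-1) ^+ n * n`!%:R : R) t (1 : R)) D5) D3.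
exact: (is_derive_continuous D4).
Qed.

(** The bound does not depend on [r] or [t], so a constant can serve as dominating function; the
    powers of 2 come from [1 / (1 + r * t) <= 2]. *)
Lemma lnq_kernel_bound n (r t : R) : - 2^-1 < r -> t \in `[0, 1]%R ->
  `|lnq_kernel n r t| <= n`!%:R * 2 ^+ n.+1.
Proof.
move=> r0 t01; have h := half_le_1D r0 t01.
rewrite /lnq_kernel !normrM normrX normrN1 expr1n mul1r !normrX normfV.
rewrite ger0_norm ?ler0n// -mulrA ler_wpM2l ?ler0n//.
have /andP[t0 t1] : 0 <= t <= 1 by move: t01; rewrite in_itv.
rewrite -[leRHS]mul1r ler_pM ?exprn_ge0 ?normr_ge0 ?invr_ge0//.
  by rewrite ger0_norm// exprn_ile1.
rewrite lerXn2r ?nnegrE ?invr_ge0 ?normr_ge0//.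
rewrite ger0_norm; last by apply: le_trans h; rewrite invr_ge0.
by rewrite -[leRHS]invrK lef_pV2// posrE; [lra|rewrite invr_gt0].
Qed.

Lemma lnq_kernel_integrable n r : - 2^-1 < r ->
  mu.-integrable `[0, 1] (EFin \o lnq_kernel n r).
Proof.
move=> r0; apply: continuous_integrable => t t01.
apply: lnq_kernel_continuous; rewrite gt_eqF//.
by apply: lt_le_trans (half_le_1D r0 t01); rewrite invr_gt0.
Qed.

Lemma lnq_derive n (r : R) : - 2^-1 < r -> is_derive r (1 : R) (lnq n) (lnq n.+1 r).
Proof.
move=> r0.
pose B := `[0, 1]%classic : set R.
(* The bound of [lnq_kernel_bound] at order [n.+1], valid for the whole neighbourhood []-1/2, r +
   1[] of [r]. *)
pose G (t : R) : R := n.+1`!%:R * 2 ^+ n.+2.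
have Ir : `]-2^-1, r + 1[ r by rewrite /= in_itv/= r0/=; lra.
have I0 s : `]-2^-1, r + 1[ s -> - 2^-1 < s by rewrite /= in_itv/= => /andP[].
have nz s t : `]-2^-1, r + 1[ s -> B t -> 1 + s * t != 0.
  move=> /I0 s0 t01; rewrite gt_eqF//.
  by apply: lt_le_trans (half_le_1D s0 t01); rewrite invr_gt0.
have intf s : `]-2^-1, r + 1[ s -> mu.-integrable B (EFin \o lnq_kernel n s).
  by move=> /I0; exact: lnq_kernel_integrable.
have derf s t : `]-2^-1, r + 1[ s -> B t -> derivable (lnq_kernel n ^~ t) s 1.
  by move=> Is Bt; have [] := lnq_kernel_derive n (nz _ _ Is Bt).
have d1E s t : `]-2^-1, r + 1[ s -> B t ->
    partial1of2 (lnq_kernel n) s t = lnq_kernel n.+1 s t.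
  move=> Is Bt; rewrite partial1of2E.
  by have D := lnq_kernel_derive n (nz _ _ Is Bt); exact: derive_val.
have G0 t : 0 <= G t by rewrite mulr_ge0// exprn_ge0.
have intG : mu.-integrable B (EFin \o G).
  by apply: continuous_integrable => t _; exact: cst_continuous.
have Gub s t : `]-2^-1, r + 1[ s -> B t ->
    `|partial1of2 (lnq_kernel n) s t| <= G t.
  by move=> Is Bt; rewrite d1E//; apply: lnq_kernel_bound => //; exact: I0.
have mB : measurable (B : set (measurableTypeR R)) by exact: measurable_itv.
split; first exact: (derivable_under_integral mB Ir intf derf G0 intG Gub).
rewrite -derive1E (differentiation_under_integral mB Ir intf derf G0 intG Gub).
by apply: eq_Rintegral => t; rewrite inE => Bt; exact: d1E.
Qed.

(** A primitive in [t] of [r / (1 + r * t)] is [ln (1 + r * t)]. The product form also covers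
    [r = 0]. *)
Lemma lnq0E (r : R) : - 2^-1 < r -> r * lnq 0 r = ln (1 + r).
Proof.
move=> r0.
have nz t : t \in `[0, 1]%R -> 0 < 1 + r * t.
  by move=> t01; apply: lt_le_trans (half_le_1D r0 t01); rewrite invr_gt0.
rewrite /lnq -RintegralZl//; last exact: lnq_kernel_integrable.
have cf (t : R) :
    t \in `[0, 1]%R -> {for t, continuous (fun t => r * lnq_kernel 0 r t)}.
  move=> t01; apply: cvgM; first exact: cvg_cst.
  by apply: lnq_kernel_continuous; rewrite gt_eqF// nz.
have dF (t : R) : t \in `[0, 1]%R ->
    is_derive t (1 : R) (fun s => ln (1 + r * s)) (r * lnq_kernel 0 r t).
  move=> t01.
  have D := is_derive_lnf (f := fun s : R => 1 + r * s) (nz _ t01)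
    (is_derive_affine 1 r t).
  by apply: (is_derive_eq D); rewrite /lnq_kernel expr0 fact0 !mul1r expr1.
by rewrite (Rintegral_derive ltr01 cf dF) mulr1 mulr0 addr0 ln1 subr0.
Qed.

(** Both sides are the derivative of [r * lnq 0 r = ln (1 + r)]. The left side is the combination
    that appears in the second derivatives of the potential. *)
Lemma lnq1E (r : R) : 0 <= r -> lnq 0 r + r * lnq 1 r = (1 + r)^-1.
Proof.
move=> r0; have r1 : - 2^-1 < r by lra.
have D : is_derive r (1 : R) (fun s => s * lnq 0 s) (lnq 0 r + r * lnq 1 r).
  have D := is_derive_mul (is_derive_id _ _) (lnq_derive 0 r1).
  by apply: (is_derive_eq D); rewrite mul1r.
have D1 : is_derive r (1 : R) (fun s : R => 1 + s) 1.
  by have := is_derive_affine 1 1 r; under eq_fun do rewrite mul1r.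
have r2 : 0 < 1 + r by lra.
have D2 := is_derive_lnf (f := fun s : R => 1 + s) r2 D1; rewrite div1r in D2.
have D3 : is_derive r (1 : R) (fun s => s * lnq 0 s) (1 + r)^-1.
  apply: near_eq_is_derive D2 => //.
  near=> s; apply/esym/lnq0E; near: s.
  exact: lt_nbhsr.
by rewrite -(@derive_val _ _ _ _ _ _ _ D) -(@derive_val _ _ _ _ _ _ _ D3).
Unshelve. all: by end_near. Qed.

(* [- Li2 (- r)] for [0 <= r]; starting the integral at -1/4 makes it
   differentiable on both sides of 0. *)
Definition Li2neg (r : R) : R :=
  \int[mu]_(s in `[- 4^-1, r]) lnq 0 s - \int[mu]_(s in `[- 4^-1, 0]) lnq 0 s.

Lemma lnq_continuous n (r : R) : - 2^-1 < r -> {for r, continuous (lnq n)}.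
Proof. by move=> r0; exact: (is_derive_continuous (lnq_derive n r0)). Qed.

Lemma Li2neg_derive (r : R) : 0 <= r -> is_derive r (1 : R) Li2neg (lnq 0 r).
Proof.
move=> r0.
have int : mu.-integrable `[- 4^-1, r + 1] (EFin \o lnq 0).
  apply: continuous_integrable => s; rewrite in_itv/= => /andP[s0 _].
  by apply: lnq_continuous; lra.
have ru : r < r + 1 by lra.
have ar : - 4^-1 < r by lra.
have [] := @continuous_FTC1_closed _ _ (- 4^-1) r _ ru int ar.
  by apply: lnq_continuous; lra.
move=> dF Fr.
rewrite derive1E in Fr.
have := is_derive_add (derivableP dF)
  (is_derive_cst (- \int[mu]_(s in `[- 4^-1, 0]) lnq 0 s) _ _).
by rewrite addr0 Fr.
Qed.

Lemma Li2E (r : R) : 0 <= r -> - Li2 (- r) = Li2neg r.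
Proof.
rewrite /Li2 opprK le_eqVlt => /predU1P[<-|r0].
  by rewrite /Li2neg subrr oppr0 /oint lexx set_itv1 Rintegral_set1.
rewrite /oint ifF; last by apply/negbTE; rewrite -ltNge; lra.
have cf : forall u, u \in `[- r, 0]%R -> {for u, continuous (fun u => lnq 0 (- u))}.
  move=> u; rewrite in_itv/= => /andP[_ u0].
  apply: continuous_comp; first exact: opp_continuous.
  by apply: lnq_continuous; lra.
(* At [u = 0] the quotient has the default value 0 while the other side is -1. The integrals are
   thus compared on the interval without its endpoint 0, a null set. *)
have E0 : {in `[- r, 0[%classic, (fun u => - lnq 0 (- u)) =1 (fun u => ln (1 - u) / u)}.
  move=> u; rewrite inE/= in_itv/= => /andP[_ u0].
  rewrite -(@lnq0E (- u)); last by lra.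
  by field; rewrite lt_eqF.
have cNf (u : R) : u \in `[- r, 0]%R -> {for u, continuous (fun u => - lnq 0 (- u))}.
  by move=> u0; apply: cvgN; exact: cf.
have int1 : mu.-integrable `[- r, 0[ (EFin \o (fun u => - lnq 0 (- u))).
  apply: (@integrableS _ _ _ mu `[- r, 0]%classic) => //.
    exact: subset_itv_co_cc.
  exact: continuous_integrable.
have int2 : mu.-integrable `[- r, 0[ (EFin \o (fun u => ln (1 - u) / u)).
  by apply: eq_integrable int1 => // u /E0 /= ->.
have -> : \int[mu]_(u in `[- r, 0]) (ln (1 - u) / u) =
    \int[mu]_(u in `[- r, 0]) (- lnq 0 (- u)).
  rewrite -(Rintegral_itv_bndo_bndc int2) -(Rintegral_itv_bndo_bndc int1).
  by apply: eq_Rintegral => u /E0.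
have dF (u : R) : u \in `[- r, 0]%R ->
    is_derive u (1 : R) (fun u => Li2neg (- u)) (- lnq 0 (- u)).
  rewrite in_itv/= => /andP[_ u0]; have Nu : 0 <= - u by lra.
  have D := is_derive_comp (Li2neg_derive Nu) (is_deriveNid u (1 : R)).
  by apply: (is_derive_eq D); rewrite mulrN1.
have Nr0 : - r < 0 by lra.
rewrite (Rintegral_derive Nr0 cNf dF) oppr0 opprK.
by rewrite /Li2neg subrr sub0r opprK.
Qed.

End Dilogarithm.

(** * Exterior derivatives and d^c *)

(** Singletons index the type (1,1) part of a 2-form and the type (1,2) part of a 3-form. *)
Lemma sum_set1 (V : nmodType) (T : finType) (F : {set T} -> V) :
  \sum_(S : {set T} | #|S| == 1) F S = \sum_i F [set i].
Proof.
rewrite (eq_bigl (mem ((@finset.set1 T) @: finset.setT))).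
  rewrite big_imset /=; last by move=> i j _ _ /finset.set1_inj.
  by apply: eq_bigl => i; rewrite finset.in_setT.
move=> S; apply/cards1P/imsetP => [[i ->]|[i _ ->]]; exists i;
  by rewrite ?finset.in_setT.
Qed.

(** For a 3-form this enumerates the type (2,1) part, in the order that pairs each term with the
    complementary one of type (1,2). *)
Lemma sum_setC1 (V : nmodType) (T : finType) (F : {set T} -> V) n :
  #|T| = n.+1 -> \sum_(S : {set T} | #|S| == n) F S = \sum_i F (~: [set i]).
Proof.
move=> Tn; rewrite (reindex_inj (@finset.setC_inj T)) /=.
rewrite -(sum_set1 (fun S => F (~: S))); apply: eq_bigl => S.
rewrite cardsCs finset.setCK Tn.
have : (#|S| <= n.+1)%N by rewrite -Tn max_card.
case: #|S| => [_|m mn]; first by rewrite subn0 -[LHS]negbK neq_ltn ltnSn orbT.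
by rewrite subSS -(eqn_add2r m) subnK// -[X in X == _]addn0 eqn_add2l eq_sym.
Qed.

Lemma sum_I2 (M : nmodType) (F : 'I_2 -> M) : \sum_i F i = F 0 + F 1.
Proof.
by rewrite !big_ord_recl big_ord0 addr0; congr (_ + F _); apply: val_inj.
Qed.

Lemma sum_I3 (M : nmodType) (F : 'I_3 -> M) : \sum_i F i = F 0 + F 1 + F 2.
Proof.
rewrite !big_ord_recl big_ord0 addr0 addrA.
by congr (F _ + F _ + F _); apply: val_inj.
Qed.

(** * Complexified forms, their exterior derivative, and d^c of a (1,1)-form *)

Section Bilinear.
Variables (R : realType) (n : nat).
Local Notation V := 'cV[R]_n.+1.
Local Notation VC := 'cV[R[i]]_n.+1.
Implicit Types (W : 'M[R[i]]_n.+1) (u w : VC).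

(** The value of the 2-form on the pair [(u, w)]: as in [form2], the first argument multiplies the
    matrix on the right. *)
Definition bilC W u w : R[i] := (w^T *m W *m u) 0 0.

Lemma bilCDl W u u' w : bilC W (u + u') w = bilC W u w + bilC W u' w.
Proof. by rewrite /bilC mulmxDr mxE. Qed.

Lemma bilCZl W a u w : bilC W (a *: u) w = a * bilC W u w.
Proof. by rewrite /bilC -scalemxAr mxE. Qed.

Lemma bilCDr W u w w' : bilC W u (w + w') = bilC W u w + bilC W u w'.
Proof. by rewrite /bilC linearD /= !mulmxDl mxE. Qed.

Lemma bilCZr W a u w : bilC W u (a *: w) = a * bilC W u w.
Proof. by rewrite /bilC linearZ /= -!scalemxAl mxE. Qed.

Lemma bilCE W u w : bilC W u w = \sum_j \sum_i w i 0 * u j 0 * W i j.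
Proof.
rewrite /bilC mxE; apply: eq_bigr => j _; rewrite mxE big_distrl /=.
by apply: eq_bigr => i _; rewrite mxE mulrAC.
Qed.

Section ComplexDerivative.
Implicit Types (f g : V -> R[i]) (x : V) (j : 'I_n.+1).

Definition is_cpartial j f x (d : R[i]) : Prop :=
  is_derive x (delta_mx j 0) (fun y => complex.Re (f y)) (complex.Re d) /\
  is_derive x (delta_mx j 0) (fun y => complex.Im (f y)) (complex.Im d).

Lemma is_cpartialE j f x d : is_cpartial j f x d -> cpartial j f x = d.
Proof.
move=> [Dr Di]; rewrite /cpartial /partial.
rewrite (@derive_val _ _ _ _ _ _ _ Dr) (@derive_val _ _ _ _ _ _ _ Di).
by case: d {Dr Di}.
Qed.

Lemma is_cpartial0 j x : is_cpartial j (fun=> 0) x 0.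
Proof. by split; exact: is_derive_cst. Qed.

Lemma is_cpartialD j f g x df dg : is_cpartial j f x df -> is_cpartial j g x dg ->
  is_cpartial j (fun y => f y + g y) x (df + dg).
Proof.
move=> [fr fi] [gr gi]; split.
  have -> : (fun y => complex.Re (f y + g y)) =
      fun y => complex.Re (f y) + complex.Re (g y).
    by apply/funext => y; case: (f y) => ? ?; case: (g y).
  have -> : complex.Re (df + dg) = complex.Re df + complex.Re dg.
    by case: df {fr fi} => ? ?; case: dg {gr gi}.
  exact: is_derive_add.
have -> : (fun y => complex.Im (f y + g y)) =
    fun y => complex.Im (f y) + complex.Im (g y).
  by apply/funext => y; case: (f y) => ? ?; case: (g y).
have -> : complex.Im (df + dg) = complex.Im df + complex.Im dg.
  by case: df {fr fi} => ? ?; case: dg {gr gi}.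
exact: is_derive_add.
Qed.

Lemma is_cpartial_sum (I : Type) (s : seq I) j (f : I -> V -> R[i]) x df :
  (forall i, is_cpartial j (f i) x (df i)) ->
  is_cpartial j (fun y => \sum_(i <- s) f i y) x (\sum_(i <- s) df i).
Proof.
move=> D; elim: s => [|i s IH].
  by under eq_fun do rewrite big_nil; rewrite big_nil; exact: is_cpartial0.
under eq_fun do rewrite big_cons; rewrite big_cons.
exact: is_cpartialD.
Qed.

Lemma is_cpartial_scale j (a : V -> R) x da (z : R[i]) :
  is_derive x (delta_mx j 0) a da ->
  is_cpartial j (fun y => z * (a y)%:C) x (z * da%:C).
Proof.
move=> Da; case: z => p q.
have D r : is_derive x (delta_mx j 0) (fun y => r * a y) (r * da).
  have D1 := is_derive_mul (is_derive_cst (r : R) x (delta_mx j 0)) Da.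
  by apply: (is_derive_eq D1); rewrite mul0r add0r.
split.
  have -> : (fun y => complex.Re ((p +i* q) * (a y)%:C)) = fun y => p * a y.
    by apply/funext => y /=; rewrite mulr0 subr0.
  by rewrite /= mulr0 subr0; exact: D.
have -> : (fun y => complex.Im ((p +i* q) * (a y)%:C)) = fun y => q * a y.
  by apply/funext => y /=; rewrite mulr0 add0r.
by rewrite /= mulr0 add0r; exact: D.
Qed.

Lemma cdiffE f x w (df : 'I_n.+1 -> R[i]) :
  (forall j, is_cpartial j f x (df j)) -> cdiff f x w = \sum_j w j 0 * df j.
Proof. by move=> D; apply: eq_bigr => j _; rewrite (is_cpartialE (D j)). Qed.

Lemma is_cpartial_bilC j (A : V -> 'M[R]_n.+1) (dA : 'M[R]_n.+1) x u w :
  (forall k l, is_derive x (delta_mx j 0) (fun y => A y k l) (dA k l)) ->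
  is_cpartial j (fun y => bilC (map_mx (real_complex R) (A y)) u w) x
    (bilC (map_mx (real_complex R) dA) u w).
Proof.
move=> D; under eq_fun do rewrite bilCE; rewrite bilCE.
apply: is_cpartial_sum => l; apply: is_cpartial_sum => k.
by under eq_fun do rewrite mxE; rewrite mxE; exact: is_cpartial_scale.
Qed.

End ComplexDerivative.

(* [dform2 dA] is the exterior derivative of [form2 A] at a point where the
   partial derivatives of A are the matrices [dA j]. *)
Definition dbilC (dA : 'I_n.+1 -> 'M[R]_n.+1) w u u' : R[i] :=
  \sum_j w j 0 * bilC (map_mx (real_complex R) (dA j)) u u'.

Definition dform2 dA u0 u1 u2 : R[i] :=
  dbilC dA u0 u1 u2 - dbilC dA u1 u0 u2 + dbilC dA u2 u0 u1.

Lemma extd_form2 (A : V -> 'M[R]_n.+1) (dA : 'I_n.+1 -> 'M[R]_n.+1) x v :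
  (forall j k l, is_derive x (delta_mx j 0) (fun y => A y k l) (dA j k l)) ->
  extd (form2 A) x v = dform2 dA (v 0) (v 1) (v 2).
Proof.
move=> D.
have E (i : 'I_3) : cdiff (fun y => form2 A y (fun j => v (lift i j))) x (v i) =
    dbilC dA (v i) (v (lift i 0)) (v (lift i 1)).
  by apply: cdiffE => j; exact: is_cpartial_bilC.
rewrite /extd (eq_bigr (fun i : 'I_3 => (-1) ^+ i *
  dbilC dA (v i) (v (lift i 0)) (v (lift i 1)))); last by move=> i _; rewrite E.
rewrite sum_I3 /dform2 expr0 mul1r expr1 mulN1r sqrrN expr1n mul1r.
have lifts : [/\ lift (0 : 'I_3) (0 : 'I_2) = 1, lift (0 : 'I_3) (1 : 'I_2) = 2,
    lift (1 : 'I_3) (0 : 'I_2) = 0, lift (1 : 'I_3) (1 : 'I_2) = 2 &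
    lift (2 : 'I_3) (0 : 'I_2) = 0 /\ lift (2 : 'I_3) (1 : 'I_2) = 1].
  by split; try split; apply: val_inj.
by case: lifts => -> -> -> -> [-> ->].
Qed.

Lemma dbilCDw dA w w' u u' :
  dbilC dA (w + w') u u' = dbilC dA w u u' + dbilC dA w' u u'.
Proof. by rewrite /dbilC -big_split; apply: eq_bigr => j _; rewrite mxE mulrDl. Qed.

Lemma dbilCZw dA a w u u' : dbilC dA (a *: w) u u' = a * dbilC dA w u u'.
Proof. by rewrite /dbilC big_distrr; apply: eq_bigr => j _ /=; rewrite mxE mulrA. Qed.

Lemma dbilCDl dA w u t u' : dbilC dA w (u + t) u' = dbilC dA w u u' + dbilC dA w t u'.
Proof. by rewrite /dbilC -big_split; apply: eq_bigr => j _; rewrite bilCDl mulrDr. Qed.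

Lemma dbilCZl dA a w u u' : dbilC dA w (a *: u) u' = a * dbilC dA w u u'.
Proof. by rewrite /dbilC big_distrr; apply: eq_bigr => j _ /=; rewrite bilCZl mulrCA. Qed.

Lemma dbilCDr dA w u u' t : dbilC dA w u (u' + t) = dbilC dA w u u' + dbilC dA w u t.
Proof. by rewrite /dbilC -big_split; apply: eq_bigr => j _; rewrite bilCDr mulrDr. Qed.

Lemma dbilCZr dA a w u u' : dbilC dA w u (a *: u') = a * dbilC dA w u u'.
Proof. by rewrite /dbilC big_distrr; apply: eq_bigr => j _ /=; rewrite bilCZr mulrCA. Qed.

Definition trilinear (T : VC -> VC -> VC -> R[i]) : Prop :=
  [/\ forall a b u u' w t, T (a *: u + b *: u') w t = a * T u w t + b * T u' w t,
      forall a b u u' w t, T w (a *: u + b *: u') t = a * T w u t + b * T w u' t &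
      forall a b u u' w t, T w t (a *: u + b *: u') = a * T w t u + b * T w t u'].

Lemma trilinearE T a0 b0 a1 b1 a2 b2 u0 w0 u1 w1 u2 w2 : trilinear T ->
  T (a0 *: u0 + b0 *: w0) (a1 *: u1 + b1 *: w1) (a2 *: u2 + b2 *: w2) =
  a0 * (a1 * (a2 * T u0 u1 u2 + b2 * T u0 u1 w2) +
        b1 * (a2 * T u0 w1 u2 + b2 * T u0 w1 w2)) +
  b0 * (a1 * (a2 * T w0 u1 u2 + b2 * T w0 u1 w2) +
        b1 * (a2 * T w0 w1 u2 + b2 * T w0 w1 w2)).
Proof. by move=> [T0 T1 T2]; rewrite T0 !T1 !T2. Qed.

Section Dc.
Variables (I A : V -> 'M[R]_n.+1).
Hypothesis I2 : forall x, I x *m I x = - 1%:M.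
Hypothesis A11 : forall x, (I x)^T *m A x *m I x = A x.
Local Notation J x := (map_mx (real_complex R) (I x)).
Local Notation W x := (map_mx (real_complex R) (A x)).

Lemma proj10E x w : proj10 (I x) w = 2^-1 *: w + (- (2^-1 * 'i)) *: (J x *m w).
Proof. by rewrite /proj10 scalerBr scalerA scaleNr. Qed.

Lemma proj01E x w : proj01 (I x) w = 2^-1 *: w + (2^-1 * 'i) *: (J x *m w).
Proof. by rewrite /proj01 scalerDr scalerA. Qed.

Lemma bilC_J x u w : bilC (W x) (J x *m u) (J x *m w) = bilC (W x) u w.
Proof.
rewrite /bilC trmx_mul -!mulmxA (mulmxA (W x)) (mulmxA (J x)^T).
by rewrite map_trmx -!map_mxM (mulmxA (I x)^T) A11.
Qed.

Lemma bilC_Jl x u w : bilC (W x) (J x *m u) w = - bilC (W x) u (J x *m w).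
Proof.
rewrite -(bilC_J x (J x *m u)) mulmxA -map_mxM I2 map_mxN map_mx1 mulNmx mul1mx.
by rewrite -scaleN1r bilCZl mulN1r.
Qed.

Lemma sqr_i : 'i * 'i = -1 :> R[i].
Proof. by apply/eqP; rewrite eq_complex /=; apply/andP; split; apply/eqP; ring. Qed.

(** Both arguments are eigenvectors of [J x] for 'i, so invariance under [J x] multiplies the value
    by ['i * 'i = -1]. *)
Lemma bilC_proj10 x u w : bilC (W x) (proj10 (I x) u) (proj10 (I x) w) = 0.
Proof.
rewrite !proj10E !(bilCDl, bilCDr, bilCZl, bilCZr) bilC_J bilC_Jl.
by ring: sqr_i.
Qed.

Lemma bilC_proj01 x u w : bilC (W x) (proj01 (I x) u) (proj01 (I x) w) = 0.
Proof.
rewrite !proj01E !(bilCDl, bilCDr, bilCZl, bilCZr) bilC_J bilC_Jl.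
by ring: sqr_i.
Qed.

Lemma type_partE (S : {set 'I_2}) x (v : 'I_2 -> VC) :
  form2 A x (fun i => if i \in S then proj10 (I x) (v i) else proj01 (I x) (v i)) =
  bilC (W x) (if (0 : 'I_2) \in S then proj10 (I x) (v 0) else proj01 (I x) (v 0))
             (if (1 : 'I_2) \in S then proj10 (I x) (v 1) else proj01 (I x) (v 1)).
Proof. by []. Qed.

Lemma type_part1 : type_part I 1 (form2 A) = form2 A.
Proof.
apply/funext => x; apply/funext => v; rewrite /type_part sum_set1 sum_I2 !type_partE.
rewrite !finset.in_set1 /= !proj10E !proj01E.
rewrite !(bilCDl, bilCDr, bilCZl, bilCZr) bilC_J bilC_Jl.
rewrite -[form2 A x v]/(bilC (W x) (v 0) (v 1)).
by field: sqr_i.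
Qed.

Lemma type_part0 : type_part I 0 (form2 A) = fun _ _ => 0.
Proof.
apply/funext => x; apply/funext => v.
rewrite /type_part (eq_bigl (pred1 finset.set0)); last by move=> S; rewrite cards_eq0.
by rewrite big_pred1_eq type_partE !finset.in_set0 bilC_proj01.
Qed.

Lemma type_part2 : type_part I 2 (form2 A) = fun _ _ => 0.
Proof.
apply/funext => x; apply/funext => v.
rewrite /type_part (eq_bigl (pred1 finset.setT)); last first.
  move=> S /=; rewrite eqEcard finset.subsetT cardsT card_ord eqn_leq.
  by rewrite -[X in (_ <= X)%N](card_ord 2) max_card.
by rewrite big_pred1_eq type_partE !finset.in_setT bilC_proj10.
Qed.

Lemma extd0 k : extd (fun (_ : V) (_ : 'I_k -> VC) => 0 : R[i]) = fun _ _ => 0.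
Proof.
apply/funext => x; apply/funext => v; rewrite /extd big1// => i _.
rewrite (@cdiffE (fun=> 0) x (v i) (fun=> 0) (fun j => is_cpartial0 j x)).
by rewrite big1 ?mulr0// => j _; rewrite mulr0.
Qed.

Lemma type_part_zero k p :
  type_part I p (fun (_ : V) (_ : 'I_k -> VC) => 0 : R[i]) = fun _ _ => 0.
Proof. by apply/funext => x; apply/funext => v; rewrite /type_part big1. Qed.

(** The parts of type (0,2) and (2,0) vanish, so only [p = 1] survives in the sums that define [del]
    and [delbar]. *)
Lemma dc_form11 x v : dc I (form2 A) x v =
  'i * (type_part I 1 (extd (form2 A)) x v - type_part I 2 (extd (form2 A)) x v).
Proof.
rewrite /dc /delbar /del !sum_I3 type_part0 type_part1 type_part2 extd0 !type_part_zero.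
by rewrite !addr0 !add0r.
Qed.

(* With respect to a complex structure, [-4 dc] of a (1,1)-form w is the sum of
   the derivation of the 3-form dw by I and of [3 I^* dw]. *)
Lemma dc_form11E (T : VC -> VC -> VC -> R[i]) x (v : 'I_3 -> VC) :
  trilinear T ->
  (forall t : 'I_3 -> VC, extd (form2 A) x t = T (t 0) (t 1) (t 2)) ->
  let I0 := J x *m v 0 in let I1 := J x *m v 1 in let I2 := J x *m v 2 in
  - 4 * dc I (form2 A) x v =
    T I0 (v 1) (v 2) + T (v 0) I1 (v 2) + T (v 0) (v 1) I2 + 3 * T I0 I1 I2.
Proof.
move=> T3 TE I0 I1 I2'; rewrite dc_form11 /type_part.
have TS (S : {set 'I_3}) : extd (form2 A) x
    (fun i => if i \in S then proj10 (I x) (v i) else proj01 (I x) (v i)) =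
  T (2^-1 *: v 0 + (if 0 \in S then - (2^-1 * 'i) else 2^-1 * 'i) *: I0)
    (2^-1 *: v 1 + (if 1 \in S then - (2^-1 * 'i) else 2^-1 * 'i) *: I1)
    (2^-1 *: v 2 + (if 2 \in S then - (2^-1 * 'i) else 2^-1 * 'i) *: I2').
  by rewrite TE; congr T; case: ifP => _; rewrite ?proj10E ?proj01E.
under eq_bigr do rewrite TS (trilinearE _ _ _ _ _ _ _ _ _ _ _ _ T3).
under [X in _ - X]eq_bigr do rewrite TS (trilinearE _ _ _ _ _ _ _ _ _ _ _ _ T3).
(* Passing from a singleton to its complement flips the sign of every [I]-term. In the difference
   the terms with an even number of [I] cancel and the odd ones double. *)
rewrite sum_set1 sum_setC1 ?card_ord// !sum_I3 !finset.in_setC !finset.in_set1 /=.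
repeat match goal with |- context[T ?d ?w ?s] => generalize (T d w s) => ? end.
by field: sqr_i.
Qed.

End Dc.

End Bilinear.

(** * Curves and their length *)

Section Curves.
Local Open Scope classical_set_scope.
Variables (R : realType) (n : nat).
Local Notation V := 'cV[R]_n.+1.
Local Notation mu := (@lebesgue_measure R).
Implicit Types (g : V -> 'M[R]_n.+1) (c : R -> V) (f : V -> R).

Lemma curve_is_derive c s i : C1_curve c ->
  is_derive s (1 : R) (fun t => c t i 0) (derive1 c s i 0).
Proof.
move=> [dc _]; split; first by move/derivable_mxP: (dc s) => /(_ i 0).
by rewrite derive1E (derive_mx (dc s)) mxE.
Qed.

Lemma curve_continuous c : C1_curve c -> continuous c.
Proof.
by move=> [dc _] s; apply: differentiable_continuous; apply/derivable1_diffP.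
Qed.

Lemma coord_curve_continuous c i : continuous c -> continuous (fun s => c s i 0).
Proof.
move=> cc s; apply: (@continuous_comp _ _ _ c (fun x : V => x i 0)); first exact: cc.
exact: coord_continuous.
Qed.

Lemma speed_continuous g c : (forall i j, continuous (fun x => g x i j)) ->
  C1_curve c ->
  continuous (fun s => Num.sqrt (bil (g (c s)) (derive1 c s) (derive1 c s))).
Proof.
move=> cg C1.
have cd i : continuous (fun s => derive1 c s i 0).
  by apply: coord_curve_continuous; case: C1.
have cgc i j : continuous (fun s => g (c s) i j).
  move=> s; apply: (@continuous_comp _ _ _ c (fun x => g x i j)); last exact: cg.
  exact: curve_continuous.
have cb : continuous (fun s => bil (g (c s)) (derive1 c s) (derive1 c s)).
  have -> : (fun s => bil (g (c s)) (derive1 c s) (derive1 c s)) = fun s =>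
      \sum_j (\sum_i derive1 c s i 0 * g (c s) i j) * derive1 c s j 0.
    apply/funext => s; rewrite /bil mxE; apply: eq_bigr => j _; congr (_ * _).
    by rewrite mxE; apply: eq_bigr => i _; rewrite mxE.
  apply: continuous_sum => j; apply: continuous_mul; last exact: cd.
  by apply: continuous_sum => i; exact: continuous_mul.
by move=> s; apply: continuous_comp; [exact: cb|exact: sqrt_continuous].
Qed.

Lemma curve_length_ge0 g c : 0 <= curve_length g c.
Proof. by apply: Rintegral_ge0 => s _; exact: sqrtr_ge0. Qed.

Lemma joined_length_ge0 g x y l : joined_by_length g x y l -> 0 <= l.
Proof. by elim=> // {x y l} c y l _ _ l0; rewrite addr_ge0 ?curve_length_ge0. Qed.

(** The increment of [f] is the integral of [df], compared pointwise with the speed. The bound is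
    asked in squared form because that is what estimates on the quadratic form provide. *)
Lemma curve_lipschitz g c f (df : R -> R) (L : R) :
  (forall i j, continuous (fun x => g x i j)) -> C1_curve c ->
  (forall s, is_derive s (1 : R) (fun t => f (c t)) (df s)) -> continuous df ->
  0 <= L ->
  (forall s, df s ^+ 2 <= L ^+ 2 * bil (g (c s)) (derive1 c s) (derive1 c s)) ->
  `|f (c 1) - f (c 0)| <= L * curve_length g c.
Proof.
move=> cg C1 Df cdf L0 dfL.
have ci := speed_continuous cg C1.
have int1 : mu.-integrable `[0, 1] (EFin \o df).
  by apply: continuous_integrable => s _; exact: cdf.
have int2 : mu.-integrable `[0, 1]
    (EFin \o (fun s => Num.sqrt (bil (g (c s)) (derive1 c s) (derive1 c s)))).
  by apply: continuous_integrable => s _; exact: ci.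
rewrite -(@Rintegral_derive _ df (fun t => f (c t)) 0 1 ltr01) //; last first.
  by move=> s _; exact: cdf.
apply: le_trans (le_normr_Rintegral _ int1) _; first exact: measurable_itv.
rewrite /curve_length -RintegralZl//.
apply: le_Rintegral => //.
- apply: continuous_integrable => s _.
  by apply: continuous_comp; [exact: cdf|exact: norm_continuous].
- apply: continuous_integrable => s _.
  by apply: cvgM; [exact: cvg_cst|exact: ci].
- move=> s _; rewrite -[`|df s|]sqrtr_sqr.
  have -> : L * Num.sqrt (bil (g (c s)) (derive1 c s) (derive1 c s)) =
      Num.sqrt (L ^+ 2 * bil (g (c s)) (derive1 c s) (derive1 c s)).
    by rewrite sqrtrM ?sqr_ge0// sqrtr_sqr ger0_norm.
  by rewrite ler_wsqrtr.
Qed.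

Lemma joined_lipschitz g f (L : R) x y l :
  (forall c, C1_curve c -> `|f (c 1) - f (c 0)| <= L * curve_length g c) ->
  joined_by_length g x y l -> `|f y - f x| <= L * l.
Proof.
move=> fL; elim=> {x y l} [x|c y l C1 _ IH]; first by rewrite subrr normr0 mulr0.
rewrite mulrDr -(subrKA (f (c 1))) addrC (le_trans (ler_normD _ _))// lerD//.
exact: fL.
Qed.

Definition segment (x y : V) (s : R) : V := x + s *: (y - x).

Lemma segment_derive x y s : is_derive s (1 : R) (segment x y) (y - x).
Proof.
split.
  apply/derivable_mxP => i j.
  have -> : (fun t => segment x y t i j) = fun t => x i j + (y - x) i j * t.
    by apply/funext => t; rewrite /segment !mxE mulrC.
  by have [] := is_derive_affine (x i j) ((y - x) i j) s.
have D : derivable (segment x y) s 1.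
  apply/derivable_mxP => i j.
  have -> : (fun t => segment x y t i j) = fun t => x i j + (y - x) i j * t.
    by apply/funext => t; rewrite /segment !mxE mulrC.
  by have [] := is_derive_affine (x i j) ((y - x) i j) s.
rewrite derive_mx//; apply/matrixP => i j; rewrite !mxE.
have -> : (fun t => segment x y t i j) = fun t => x i j + (y - x) i j * t.
  by apply/funext => t; rewrite /segment !mxE mulrC.
have D1 := is_derive_affine (x i j) ((y - x) i j) s.
by rewrite (@derive_val _ _ _ _ _ _ _ D1) !mxE.
Qed.

Lemma segment_derive1 x y : derive1 (segment x y) = fun=> y - x.
Proof.
apply/funext => s; rewrite derive1E.
exact: (@derive_val _ _ _ _ _ _ _ (segment_derive x y s)).
Qed.

Lemma segment_C1 x y : C1_curve (segment x y).
Proof.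
split; first by move=> s; have [] := segment_derive x y s.
by rewrite segment_derive1; exact: cst_continuous.
Qed.

Lemma segment_joined g x y : joined_by_length g x y (curve_length g (segment x y)).
Proof.
have s0 : segment x y 0 = x by rewrite /segment scale0r addr0.
have s1 : segment x y 1 = y by rewrite /segment scale1r addrC subrK.
have := joined_cons (g := g) (segment_C1 x y) (l := 0) (y := y).
by rewrite s0 s1 addr0; apply; exact: joined_nil.
Qed.

(** After division by [L] the left side is a lower bound of the set of lengths, and the segment
    shows that this set is not empty. *)
Lemma riemannian_dist_lipschitz g f (L : R) x y : 0 < L ->
  (forall c, C1_curve c -> `|f (c 1) - f (c 0)| <= L * curve_length g c) ->
  `|f y - f x| <= L * riemannian_dist g x y.
Proof.
move=> L0 fL; rewrite -ler_pdivrMl//; apply: lb_le_inf.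
  by exists (curve_length g (segment x y)); exact: segment_joined.
by move=> l /(joined_lipschitz fL); rewrite ler_pdivrMl.
Qed.

Lemma riemannian_dist_le g x y :
  riemannian_dist g x y <= curve_length g (segment x y).
Proof.
apply: ge_inf; last exact: segment_joined.
by exists 0 => l; exact: joined_length_ge0.
Qed.

Lemma curve_length_segment_le g x y (B : R) :
  (forall i j, continuous (fun x => g x i j)) ->
  (forall z, Num.sqrt (bil (g z) (y - x) (y - x)) <= B) ->
  curve_length g (segment x y) <= B.
Proof.
move=> cg gB; have ci := speed_continuous cg (segment_C1 x y).
have cB (t : R) : t \in `[0, 1]%R -> {for t, continuous (fun _ : R => B)}.
  by move=> _; exact: cst_continuous.
have dB (t : R) : t \in `[0, 1]%R -> is_derive t (1 : R) (fun s => 0 + B * s) B.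
  by move=> _; exact: is_derive_affine.
have -> : B = \int[mu]_(s in `[0, 1]) B.
  by rewrite (Rintegral_derive ltr01 cB dB) !add0r mulr1 mulr0 subr0.
apply: le_Rintegral => //.
- by apply: continuous_integrable => s _; exact: ci.
- by apply: continuous_integrable => s _; exact: cst_continuous.
- by move=> s _; rewrite segment_derive1.
Qed.

End Curves.

(** * The potential *)

Section RadialFunctions.
Variable R : realType.
Local Notation V := 'cV[R]_4.
Implicit Types x v : V.

Lemma sum4 (T : nmodType) (F : 'I_4 -> T) : \sum_i F i = F 0 + F 1 + F 2 + F 3.
Proof.
rewrite !big_ord_recl big_ord0 addr0 !addrA.
by do 3?[congr (_ + _)]; congr F; apply: val_inj.
Qed.

Lemma forall4 (P : 'I_4 -> Prop) : P 0 -> P 1 -> P 2 -> P 3 -> forall i, P i.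
Proof.
move=> P0 P1 P2 P3 [[|[|[|[|//]]]] ?].
- by rewrite (_ : Ordinal _ = 0) //; apply: val_inj.
- by rewrite (_ : Ordinal _ = 1) //; apply: val_inj.
- by rewrite (_ : Ordinal _ = 2) //; apply: val_inj.
- by rewrite (_ : Ordinal _ = 3) //; apply: val_inj.
Qed.

(** Convertible with [nsq (q2 x)], which later proofs use to pass between the two. *)
Definition nsq2 x : R := x 2 0 ^+ 2 + x 3 0 ^+ 2.
Definition dnsq2 x v : R := 2 * (x 2 0 * v 2 0 + x 3 0 * v 3 0).

Lemma nsq2_ge0 x : 0 <= nsq2 x.
Proof. by rewrite addr_ge0 ?sqr_ge0. Qed.

Lemma nsq2_gtN x : - 2^-1 < nsq2 x.
Proof. by apply: lt_le_trans (nsq2_ge0 x); rewrite oppr_lt0 invr_gt0. Qed.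

Lemma nsq2_gt0 x : 0 < 1 + nsq2 x.
Proof. by rewrite ltr_wpDr ?nsq2_ge0. Qed.

Lemma nsq2_neq0 x : 1 + nsq2 x != 0.
Proof. by rewrite gt_eqF ?nsq2_gt0. Qed.

Lemma nsq2_derive x v : is_derive x v nsq2 (dnsq2 x v).
Proof.
have D i := is_derive_exp 2 (is_derive_coord x v i).
by apply: (is_derive_eq (is_derive_add (D 2) (D 3))); rewrite /dnsq2 /=; ring.
Qed.

Lemma inv_nsq2_derive x v :
  is_derive x v (fun y => (1 + nsq2 y)^-1) (- dnsq2 x v * (1 + nsq2 x)^-1 ^+ 2).
Proof.
apply: (is_derive_inv (f := fun y => 1 + nsq2 y)); first exact: nsq2_neq0.
have D := is_derive_add (is_derive_cst (1 : R) x v) (nsq2_derive x v).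
by apply: (is_derive_eq D); rewrite add0r.
Qed.

Lemma ln_nsq2_derive x v :
  is_derive x v (fun y => ln (1 + nsq2 y)) (dnsq2 x v / (1 + nsq2 x)).
Proof.
apply: (is_derive_lnf (f := fun y => 1 + nsq2 y)); first exact: nsq2_gt0.
have D := is_derive_add (is_derive_cst (1 : R) x v) (nsq2_derive x v).
by apply: (is_derive_eq D); rewrite add0r.
Qed.

Lemma lnq_nsq2_derive n x v :
  is_derive x v (fun y => lnq n (nsq2 y)) (lnq n.+1 (nsq2 x) * dnsq2 x v).
Proof. exact: is_derive_comp (lnq_derive n (nsq2_gtN x)) (nsq2_derive x v). Qed.

End RadialFunctions.

(** The derivative is read off the syntax of the function, and [derive_by] leaves its comparison
    with the claimed value as an algebraic identity. *)
Ltac derive_step :=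
  lazymatch goal with
  | |- is_derive _ _ (fun y => - @?f y) _ => apply: (@is_derive_opp _ _ f)
  | |- is_derive _ _ (fun y => @?f y + @?g y) _ => apply: (@is_derive_add _ _ f g)
  | |- is_derive _ _ (fun y => @?f y * @?g y) _ => apply: (@is_derive_mul _ _ f g)
  | |- is_derive _ _ (fun y => @?f y ^+ ?n) _ => apply: (@is_derive_exp _ _ n f)
  | |- is_derive _ _ (fun y => fun_of_matrix y _ _) _ => apply: is_derive_coord
  | |- is_derive _ _ (fun y => expR (@?f y)) _ =>
      apply: (is_derive_comp (f := f) (is_derive_expR _))
  | |- is_derive _ _ (fun y => cos (@?f y)) _ =>
      apply: (is_derive_comp (f := f) (is_derive_cos _))
  | |- is_derive _ _ (fun y => sin (@?f y)) _ =>
      apply: (is_derive_comp (f := f) (is_derive_sin _))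
  | |- is_derive _ _ (fun y => nsq2 y) _ => apply: nsq2_derive
  | |- is_derive _ _ (fun y => (@?f y)^-1) _ =>
      first [apply: inv_nsq2_derive | apply: is_derive_cst]
  | |- is_derive _ _ (fun y => ln (@?f y)) _ => apply: ln_nsq2_derive
  | |- is_derive _ _ (fun y => lnq _ (@?f y)) _ => apply: lnq_nsq2_derive
  | |- is_derive _ _ (fun y => ?a) _ => apply: is_derive_cst
  end.
Ltac derive_by := apply: is_derive_eq; [repeat derive_step|].

Section RadialSmoothness.
Variables (R : realType) (c : R).
Local Notation V := 'cV[R]_4.
Implicit Types x v : V.

Lemma Kpot_derive x v : is_derive x v (Kpot c)
  (2 / c * (x 0 0 * v 0 0 + x 1 0 * v 1 0) + lnq 0 (nsq2 x) * dnsq2 x v).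
Proof.
(* [Li2neg] is differentiable on both sides of 0, so the chain rule also applies where [q2 = 0]. *)
have -> : Kpot c = fun y => (y 0 0 ^+ 2 + y 1 0 ^+ 2) / c + Li2neg (nsq2 y).
  by apply/funext => y; rewrite -Li2E // nsq2_ge0.
have D : is_derive x v (fun y => Li2neg (nsq2 y)) (lnq 0 (nsq2 x) * dnsq2 x v).
  exact: is_derive_comp (Li2neg_derive (nsq2_ge0 x)) (nsq2_derive x v).
have D1 : is_derive x v (fun y : V => (y 0 0 ^+ 2 + y 1 0 ^+ 2) / c)
    (2 / c * (x 0 0 * v 0 0 + x 1 0 * v 1 0)).
  by derive_by; rewrite /=; ring.
exact: is_derive_add D1 D.
Qed.

Lemma partial_eq j (f : V -> R) x d :
  is_derive x (delta_mx j 0) f d -> partial j f x = d.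
Proof. by move=> D; exact: derive_val. Qed.

Lemma partial_Kpot j x : partial j (Kpot c) x =
  2 / c * (x 0 0 * (j == 0)%:R + x 1 0 * (j == 1)%:R) +
  lnq 0 (nsq2 x) * (2 * (x 2 0 * (j == 2)%:R + x 3 0 * (j == 3)%:R)).
Proof.
rewrite (partial_eq (Kpot_derive _ _)) /dnsq2 !mxE !andbT.
by rewrite ![_ == j]eq_sym.
Qed.

Lemma smooth_nsq2 : smooth (@nsq2 R : V -> R).
Proof. by apply: smoothD; apply: smoothX; exact: smooth_coord. Qed.

Lemma smooth_lnq n : smooth (fun x : V => lnq n (nsq2 x)).
Proof.
apply: (@smooth_comp _ _ (@lnq R)); last exact: smooth_nsq2.
by move=> m x; exact: lnq_derive (nsq2_gtN x).
Qed.

Lemma smooth_inv_nsq2 : smooth (fun x : V => (1 + nsq2 x)^-1).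
Proof.
apply: smoothV; first exact: nsq2_neq0.
by apply: smoothD; [exact: smooth_cst|exact: smooth_nsq2].
Qed.

Lemma smooth_ln_nsq2 : smooth (fun x : V => ln (1 + nsq2 x)).
Proof.
apply: smooth_ln; first exact: nsq2_gt0.
by apply: smoothD; [exact: smooth_cst|exact: smooth_nsq2].
Qed.

End RadialSmoothness.

Ltac smooth_step :=
  lazymatch goal with
  | |- smooth (fun y => - @?f y) => apply: (@smoothN _ _ f)
  | |- smooth (fun y => @?f y + @?g y) => apply: (@smoothD _ _ f g)
  | |- smooth (fun y => @?f y * @?g y) => apply: (@smoothM _ _ f g)
  | |- smooth (fun y => @?f y ^+ ?n) => apply: (@smoothX _ _ n f)
  | |- smooth (fun y => fun_of_matrix y _ _) => apply: smooth_coord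
  | |- smooth (fun y => lnq _ (@?f y)) => apply: smooth_lnq
  | |- smooth (fun y => ln (@?f y)) => apply: smooth_ln_nsq2
  | |- smooth (fun y => (@?f y)^-1) =>
      first [apply: smooth_inv_nsq2 | apply: smooth_cst]
  | |- smooth (fun y => nsq2 y) => apply: smooth_nsq2
  | |- smooth (fun y => expR (@?f y)) => apply: (@smooth_expR _ _ f)
  | |- smooth (fun y => cos (@?f y)) => apply: (proj1 (@smooth_trig _ _ f _))
  | |- smooth (fun y => sin (@?f y)) => apply: (proj2 (@smooth_trig _ _ f _))
  | |- smooth (fun y => ?c) => apply: smooth_cst
  end.
Ltac smooth_by := repeat smooth_step.

Section Potential.
Variables (R : realType) (c : R).
Local Notation V := 'cV[R]_4.
Implicit Types x v : V.

(** One derivative of [Li2neg] is enough: the gradient is an explicit expression in [lnq 0], already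
    known to be smooth. *)
Lemma smooth_Kpot : smooth (Kpot c : V -> R).
Proof.
apply: (smooth_derive (Df := fun j x =>
  2 / c * (x 0 0 * (j == 0)%:R + x 1 0 * (j == 1)%:R) +
  lnq 0 (nsq2 x) * (2 * (x 2 0 * (j == 2)%:R + x 3 0 * (j == 3)%:R)))).
- have -> : Kpot c = fun y => (y 0 0 ^+ 2 + y 1 0 ^+ 2) / c + Li2neg (nsq2 y).
    by apply/funext => y; rewrite -Li2E // nsq2_ge0.
  have c1 : continuous (fun y : V => (y 0 0 ^+ 2 + y 1 0 ^+ 2) / c).
    by apply: smooth_continuous; smooth_by.
  have c2 : continuous (fun y : V => Li2neg (nsq2 y)).
    move=> x; apply: continuous_comp; first exact/smooth_continuous/smooth_nsq2.
    exact: (is_derive_continuous (Li2neg_derive (nsq2_ge0 x))).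
  by move=> x; exact: (continuousD (c1 x) (c2 x)).
- move=> j x; rewrite -partial_Kpot; have D := Kpot_derive c x (delta_mx j 0).
  exact: derivableP.
- by move=> j; smooth_by.
Qed.

Hypothesis c0 : c != 0.

Lemma half_complex : 2^-1 = (2^-1)%:C :> R[i].
Proof. by rewrite fmorphV rmorph_nat. Qed.

Lemma d_q1K : d_q1 (cfun (Kpot c)) = fun x : V => (x 0 0 / c) +i* (- (x 1 0 / c)).
Proof.
apply/funext => x; rewrite /d_q1 /wirt /cpartial /cfun /= !partial_Kpot.
rewrite !(partial_eq (is_derive_cst _ _ _)) half_complex.
by apply/eqP; rewrite eq_complex /=; apply/andP; split; apply/eqP; field.
Qed.

Lemma d_q1barK : d_q1bar (cfun (Kpot c)) = fun x : V => (x 0 0 / c) +i* (x 1 0 / c).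
Proof.
apply/funext => x; rewrite /d_q1bar /wirtbar /cpartial /cfun /= !partial_Kpot.
rewrite !(partial_eq (is_derive_cst _ _ _)) half_complex.
by apply/eqP; rewrite eq_complex /=; apply/andP; split; apply/eqP; field.
Qed.

Lemma d_q2K : d_q2 (cfun (Kpot c)) =
  fun x : V => (x 2 0 * lnq 0 (nsq2 x)) +i* (- (x 3 0 * lnq 0 (nsq2 x))).
Proof.
apply/funext => x; rewrite /d_q2 /wirt /cpartial /cfun /= !partial_Kpot.
rewrite !(partial_eq (is_derive_cst _ _ _)) half_complex.
by apply/eqP; rewrite eq_complex /=; apply/andP; split; apply/eqP; field.
Qed.

Lemma d_q2barK : d_q2bar (cfun (Kpot c)) =
  fun x : V => (x 2 0 * lnq 0 (nsq2 x)) +i* (x 3 0 * lnq 0 (nsq2 x)).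
Proof.
apply/funext => x; rewrite /d_q2bar /wirtbar /cpartial /cfun /= !partial_Kpot.
rewrite !(partial_eq (is_derive_cst _ _ _)) half_complex.
by apply/eqP; rewrite eq_complex /=; apply/andP; split; apply/eqP; field.
Qed.

Lemma d_q1q1barK x : d_q1 (d_q1bar (cfun (Kpot c))) x = (c^-1)%:C.
Proof.
rewrite d_q1barK /d_q1 /wirt /cpartial /= half_complex.
have D i j : partial j (fun y : V => y i 0 / c) x = (i == j)%:R / c.
  by apply: partial_eq; derive_by; rewrite /= mxE andbT; ring.
rewrite !D; apply/eqP; rewrite eq_complex /=; apply/andP; split; apply/eqP; field => //.
Qed.

Lemma partial_lnq (i j : 'I_4) x : partial j (fun y : V => y i 0 * lnq 0 (nsq2 y)) x =
  (i == j)%:R * lnq 0 (nsq2 x) + x i 0 * (lnq 1 (nsq2 x) *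
    (2 * (x 2 0 * (j == 2)%:R + x 3 0 * (j == 3)%:R))).
Proof.
apply: partial_eq; derive_by; rewrite /= /dnsq2 !mxE !andbT.
by rewrite ![_ == j]eq_sym.
Qed.

Lemma lnq1_nsq2 x : lnq 1 (nsq2 x) * nsq2 x = (1 + nsq2 x)^-1 - lnq 0 (nsq2 x).
Proof. by rewrite -(lnq1E (nsq2_ge0 x)) mulrC; ring. Qed.

Lemma d_q2q2barK x : d_q2 (d_q2bar (cfun (Kpot c))) x = ((1 + nsq (q2 x))^-1)%:C.
Proof.
rewrite d_q2barK /d_q2 /wirt /cpartial /= half_complex !partial_lnq /=.
apply/eqP; rewrite eq_complex /=; apply/andP; split; apply/eqP; last by field.
have := lnq1_nsq2 x; rewrite -[nsq (q2 x)]/(nsq2 x); set h := _^-1 => H.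
have -> : h = lnq 0 (nsq2 x) + lnq 1 (nsq2 x) * nsq2 x by rewrite H; ring.
by rewrite /nsq2; field.
Qed.

Lemma d_q1q2barK x : d_q1 (d_q2bar (cfun (Kpot c))) x = 0.
Proof.
rewrite d_q2barK /d_q1 /wirt /cpartial /= half_complex !partial_lnq /=.
by apply/eqP; rewrite eq_complex /=; apply/andP; split; apply/eqP; field.
Qed.

Lemma d_q2q1barK x : d_q2 (d_q1bar (cfun (Kpot c))) x = 0.
Proof.
rewrite d_q1barK /d_q2 /wirt /cpartial /= half_complex.
have D i j : partial j (fun y : V => y i 0 / c) x = (i == j)%:R / c.
  by apply: partial_eq; derive_by; rewrite /= mxE andbT; ring.
by rewrite !D; apply/eqP; rewrite eq_complex /=; apply/andP; split; apply/eqP; field.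
Qed.

End Potential.

(** * The brane and its complex structures *)

Section FourByFour.
Variable R : realType.
Local Notation V := 'cV[R]_4.

Definition mx4 (s : seq (seq R)) : 'M[R]_4 := \matrix_(i, j) (nth [::] s i)`_j.
Definition col4 (s : seq R) : V := \col_i s`_i.

Lemma eq_mx4 (A B : 'M[R]_4) : (forall i j, A i j = B i j) -> A = B.
Proof. by move=> AB; apply/matrixP. Qed.

Lemma col4P (u w : V) :
  [/\ u 0 0 = w 0 0, u 1 0 = w 1 0, u 2 0 = w 2 0 & u 3 0 = w 3 0] -> u = w.
Proof.
by move=> [? ? ? ?]; apply/matrixP => i j; rewrite ord1; move: i; apply: forall4.
Qed.

Lemma smooth_map_col4 (a0 a1 a2 a3 : V -> R) : smooth a0 -> smooth a1 ->
  smooth a2 -> smooth a3 -> smooth_map (fun x => col4 [:: a0 x; a1 x; a2 x; a3 x]).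
Proof.
move=> s0 s1 s2 s3; apply: forall4.
- by have -> : (fun x => col4 [:: a0 x; a1 x; a2 x; a3 x] 0 0) = a0
    by apply/funext => x; rewrite mxE.
- by have -> : (fun x => col4 [:: a0 x; a1 x; a2 x; a3 x] 1 0) = a1
    by apply/funext => x; rewrite mxE.
- by have -> : (fun x => col4 [:: a0 x; a1 x; a2 x; a3 x] 2 0) = a2
    by apply/funext => x; rewrite mxE.
- by have -> : (fun x => col4 [:: a0 x; a1 x; a2 x; a3 x] 3 0) = a3
    by apply/funext => x; rewrite mxE.
Qed.

Lemma J0E : J0 R = mx4 [:: [:: 0; -1; 0; 0]; [:: 1; 0; 0; 0];
                           [:: 0; 0; 0; -1]; [:: 0; 0; 1; 0]].
Proof.
apply/matrixP; apply: forall4; apply: forall4; rewrite !mxE /= ?mxE /=; ring.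
Qed.

(** An explicit inverse [J'] of the Jacobian and the intertwining relation replace a computation of
    [invmx]. *)
Lemma pullback_endE (f : V -> V) (J I J' : 'M[R]_4) x :
  jac f x *m J' = 1%:M -> jac f x *m I = J *m jac f x -> pullback_end f J x = I.
Proof.
move=> fJ' fI; have [fu _] := mulmx1_unit fJ'.
by rewrite /pullback_end -mulmxA -fI mulKmx.
Qed.

End FourByFour.

Section Brane.
Variables (R : realType) (c : R).
Hypothesis c0 : c != 0.
Local Notation V := 'cV[R]_4.
Local Notation K := (Kpot c).
Implicit Types x : V.

Lemma brane_p1 x : c_p1 (brane K x) = (- (x 1 0 / c)) +i* (- (x 0 0 / c)).
Proof.
rewrite /= d_q1K//; apply/eqP; rewrite eq_complex /=.
by apply/andP; split; apply/eqP; ring.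
Qed.

Lemma brane_p2 x : c_p2 (brane K x) =
  (- (x 3 0 * lnq 0 (nsq2 x))) +i* (- (x 2 0 * lnq 0 (nsq2 x))).
Proof.
rewrite /= d_q2K//; apply/eqP; rewrite eq_complex /=.
by apply/andP; split; apply/eqP; ring.
Qed.

Lemma tLE : tL K = fun x => col4
  [:: expR (- (x 1 0 / c)) * (cos (x 0 0 / c) * x 2 0 + sin (x 0 0 / c) * x 3 0);
      expR (- (x 1 0 / c)) * (cos (x 0 0 / c) * x 3 0 - sin (x 0 0 / c) * x 2 0);
      x 0 0; x 1 0].
Proof.
apply/funext => x; rewrite /tL /target brane_p1 /cexp /= cosN sinN.
by apply: col4P; split; rewrite !mxE /=; ring.
Qed.

Lemma sLE : sL K = fun x => col4 [:: x 2 0; x 3 0; x 0 0; x 1 0 - ln (1 + nsq2 x)].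
Proof.
apply/funext => x; rewrite /sL /source brane_p2 /=.
rewrite -(lnq0E (nsq2_gtN x)).
by apply: col4P; split; rewrite !mxE /= /nsq2; ring.
Qed.

(** Multiplication of the first complex component by [exp (i q1bar / c)], where [q1] is the second
    component. *)
Definition tL_inv (w : V) : V := col4
  [:: w 2 0; w 3 0;
      expR (w 3 0 / c) * (cos (w 2 0 / c) * w 0 0 - sin (w 2 0 / c) * w 1 0);
      expR (w 3 0 / c) * (cos (w 2 0 / c) * w 1 0 + sin (w 2 0 / c) * w 0 0)].

Definition sL_inv (w : V) : V := col4
  [:: w 2 0; w 3 0 + ln (1 + (w 0 0 ^+ 2 + w 1 0 ^+ 2)); w 0 0; w 1 0].

Lemma expRNK (a : R) : expR (- a) * expR a = 1.
Proof. by rewrite -expRD addNr expR0. Qed.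

(** Oriented with a monomial on the left, as a rewriting rule for [ring]. *)
Lemma cos2E (a : R) : cos a ^+ 2 = 1 - sin a ^+ 2.
Proof. by rewrite -[X in X - _](cos2Dsin2 a) addrK. Qed.

Lemma diffeo_tL : diffeo (tL K).
Proof.
rewrite tLE; split.
  by apply: smooth_map_col4; smooth_by.
exists tL_inv; split=> [x|w|].
- rewrite /tL_inv; apply: col4P; split; rewrite !mxE /= ?mxE //.
    ring: (expRNK (x 1 0 / c)) (cos2E (x 0 0 / c)).
  ring: (expRNK (x 1 0 / c)) (cos2E (x 0 0 / c)).
- apply: col4P; split; rewrite !mxE /= ?mxE //.
    ring: (expRNK (w 3 0 / c)) (cos2E (w 2 0 / c)).
  ring: (expRNK (w 3 0 / c)) (cos2E (w 2 0 / c)).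
- by apply: smooth_map_col4; smooth_by.
Qed.

Lemma diffeo_sL : diffeo (sL K).
Proof.
rewrite sLE; split.
  by apply: smooth_map_col4; smooth_by.
exists sL_inv; split=> [x|w|].
- by rewrite /sL_inv; apply: col4P; split; rewrite !mxE /= ?mxE //= /nsq2; ring.
- by apply: col4P; split; rewrite !mxE /= ?mxE //= /nsq2 !mxE /=; ring.
- apply: smooth_map_col4; try by smooth_by.
  apply: smoothD; first exact: smooth_coord.
  apply: smooth_ln; first by move=> x; rewrite ltr_wpDr// addr_ge0 ?sqr_ge0.
  by smooth_by.
Qed.

End Brane.

Section Jacobian.
Variable R : realType.
Local Notation V := 'cV[R]_4.

Lemma jac_col4 (a0 a1 a2 a3 d0 d1 d2 d3 : V -> R) x :
  (forall v, is_derive x v a0 (d0 v)) -> (forall v, is_derive x v a1 (d1 v)) ->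
  (forall v, is_derive x v a2 (d2 v)) -> (forall v, is_derive x v a3 (d3 v)) ->
  jac (fun y => col4 [:: a0 y; a1 y; a2 y; a3 y]) x =
  \matrix_(i, j) [:: d0 (delta_mx j 0); d1 (delta_mx j 0); d2 (delta_mx j 0);
                     d3 (delta_mx j 0)]`_i.
Proof.
move=> D0 D1 D2 D3; apply/matrixP => i j; rewrite !mxE; move: i.
apply: forall4; (apply: partial_eq; under eq_fun do rewrite mxE /=); by [].
Qed.

End Jacobian.

Ltac mx4_entries := apply: eq_mx4; apply: forall4; apply: forall4;
  rewrite ?mxE ?sum4 ?mxE /= ?sum4 ?mxE /=.

(** * The tensors of the structure as explicit matrices *)

Section ComplexStructures.
Variables (R : realType) (c : R).
Hypothesis c0 : c != 0.
Local Notation V := 'cV[R]_4.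
Local Notation K := (Kpot c).
Implicit Types x : V.

Definition Ip_mx (x : V) : 'M[R]_4 := mx4
  [:: [:: 0; -1; 0; 0]; [:: 1; 0; 0; 0];
      [:: 2 / c * x 2 0; 2 / c * x 3 0; 0; -1];
      [:: 2 / c * x 3 0; - (2 / c * x 2 0); 1; 0]].

Definition Im_mx (x : V) : 'M[R]_4 := mx4
  [:: [:: 0; -1; 2 * x 2 0 * (1 + nsq2 x)^-1; 2 * x 3 0 * (1 + nsq2 x)^-1];
      [:: 1; 0; 2 * x 3 0 * (1 + nsq2 x)^-1; - (2 * x 2 0 * (1 + nsq2 x)^-1)];
      [:: 0; 0; 0; -1]; [:: 0; 0; 1; 0]].

Definition F_mx (x : V) : 'M[R]_4 := mx4
  [:: [:: 0; - (2 / c); 0; 0]; [:: 2 / c; 0; 0; 0];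
      [:: 0; 0; 0; - (2 * (1 + nsq2 x)^-1)]; [:: 0; 0; 2 * (1 + nsq2 x)^-1; 0]].

Definition g_mx (x : V) : 'M[R]_4 := mx4
  [:: [:: 2 / c; 0; 2 / c * x 3 0 * (1 + nsq2 x)^-1;
          - (2 / c * x 2 0 * (1 + nsq2 x)^-1)];
      [:: 0; 2 / c; - (2 / c * x 2 0 * (1 + nsq2 x)^-1);
          - (2 / c * x 3 0 * (1 + nsq2 x)^-1)];
      [:: 2 / c * x 3 0 * (1 + nsq2 x)^-1; - (2 / c * x 2 0 * (1 + nsq2 x)^-1);
          2 * (1 + nsq2 x)^-1; 0];
      [:: - (2 / c * x 2 0 * (1 + nsq2 x)^-1); - (2 / c * x 3 0 * (1 + nsq2 x)^-1);
          0; 2 * (1 + nsq2 x)^-1]].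

Definition b_mx (x : V) : 'M[R]_4 := mx4
  [:: [:: 0; 0; - (2 / c * x 3 0 * (1 + nsq2 x)^-1); 2 / c * x 2 0 * (1 + nsq2 x)^-1];
      [:: 0; 0; 2 / c * x 2 0 * (1 + nsq2 x)^-1; 2 / c * x 3 0 * (1 + nsq2 x)^-1];
      [:: 2 / c * x 3 0 * (1 + nsq2 x)^-1; - (2 / c * x 2 0 * (1 + nsq2 x)^-1); 0; 0];
      [:: - (2 / c * x 2 0 * (1 + nsq2 x)^-1); - (2 / c * x 3 0 * (1 + nsq2 x)^-1);
          0; 0]].

Lemma IplusE : Iplus K = Ip_mx.
Proof.
apply/funext => x; rewrite /Iplus J0E tLE//.
set C := cos (x 0 0 / c); set S := sin (x 0 0 / c); set E := expR (- (x 1 0 / c)).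
pose E' := expR (x 1 0 / c).
have EE' : E * E' = 1 by exact: expRNK.
have CS : C ^+ 2 = 1 - S ^+ 2 by exact: cos2E.
(* The Jacobian of [tL_inv] at [tL K x], expressed in the coordinates of [x]. *)
pose J' := mx4 [:: [:: 0; 0; 1; 0]; [:: 0; 0; 0; 1];
  [:: E' * C; - (E' * S); - (x 3 0 / c); x 2 0 / c];
  [:: E' * S; E' * C; x 2 0 / c; x 3 0 / c]].
have J : jac (fun y : V => col4
    [:: expR (- (y 1 0 / c)) * (cos (y 0 0 / c) * y 2 0 + sin (y 0 0 / c) * y 3 0);
        expR (- (y 1 0 / c)) * (cos (y 0 0 / c) * y 3 0 - sin (y 0 0 / c) * y 2 0);
        y 0 0; y 1 0]) x = mx4
  [:: [:: E * (C * x 3 0 - S * x 2 0) / c; - (E * (C * x 2 0 + S * x 3 0)) / c;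
          E * C; E * S];
      [:: - (E * (C * x 2 0 + S * x 3 0)) / c;
          - (E * (C * x 3 0 - S * x 2 0)) / c; - (E * S); E * C];
      [:: 1; 0; 0; 0]; [:: 0; 1; 0; 0]].
  have D0 (v : V) : is_derive x v (fun y : V =>
      expR (- (y 1 0 / c)) * (cos (y 0 0 / c) * y 2 0 + sin (y 0 0 / c) * y 3 0))
      (E * ((C * x 3 0 - S * x 2 0) / c * v 0 0 -
        (C * x 2 0 + S * x 3 0) / c * v 1 0 + C * v 2 0 + S * v 3 0)).
    by derive_by; rewrite /= -/C -/S -/E; ring.
  have D1 (v : V) : is_derive x v (fun y : V =>
      expR (- (y 1 0 / c)) * (cos (y 0 0 / c) * y 3 0 - sin (y 0 0 / c) * y 2 0))
      (E * (- (C * x 2 0 + S * x 3 0) / c * v 0 0 -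
        (C * x 3 0 - S * x 2 0) / c * v 1 0 + C * v 3 0 - S * v 2 0)).
    by derive_by; rewrite /= -/C -/S -/E; ring.
  rewrite (jac_col4 D0 D1 (fun v => is_derive_coord x v 0)
    (fun v => is_derive_coord x v 1)).
  by mx4_entries; ring.
apply: (@pullback_endE _ _ _ _ J'); rewrite J.
  by mx4_entries; ring: EE' CS.
by mx4_entries; field.
Qed.

Lemma IminusE : Iminus K = Im_mx.
Proof.
apply/funext => x; rewrite /Iminus J0E sLE//.
have J : jac (fun y : V => col4 [:: y 2 0; y 3 0; y 0 0; y 1 0 - ln (1 + nsq2 y)]) x =
    mx4 [:: [:: 0; 0; 1; 0]; [:: 0; 0; 0; 1]; [:: 1; 0; 0; 0];
            [:: 0; 1; - (2 * x 2 0 * (1 + nsq2 x)^-1); - (2 * x 3 0 * (1 + nsq2 x)^-1)]].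
  have D3 (v : V) : is_derive x v (fun y : V => y 1 0 - ln (1 + nsq2 y))
      (v 1 0 - dnsq2 x v / (1 + nsq2 x)).
    by derive_by.
  rewrite (jac_col4 (fun v => is_derive_coord x v 2) (fun v => is_derive_coord x v 3)
    (fun v => is_derive_coord x v 0) D3).
  by mx4_entries; rewrite /dnsq2 ?mxE /=; ring.
(* The Jacobian of [sL_inv] at [sL K x]. *)
pose J' := mx4 [:: [:: 0; 0; 1; 0];
  [:: 2 * x 2 0 * (1 + nsq2 x)^-1; 2 * x 3 0 * (1 + nsq2 x)^-1; 0; 1];
  [:: 1; 0; 0; 0]; [:: 0; 1; 0; 0]].
by apply: (@pullback_endE _ _ _ _ J'); rewrite J; mx4_entries; ring.
Qed.

End ComplexStructures.

(** * The symplectic form on the brane and the metric formula *)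

Section BraneForm.
Variables (R : realType) (c : R).
Hypothesis c0 : c != 0.
Local Notation V := 'cV[R]_4.
Local Notation K := (Kpot c).
Implicit Types x : V.

Lemma cdiff_cvec (f : V -> R[i]) x X (dr di : V -> R) :
  (forall v, is_derive x v (fun y => complex.Re (f y)) (dr v)) ->
  (forall v, is_derive x v (fun y => complex.Im (f y)) (di v)) ->
  cdiff f x (cvec X) = (\sum_j X j 0 * dr (delta_mx j 0)) +i*
                       (\sum_j X j 0 * di (delta_mx j 0)).
Proof.
move=> Dr Di; rewrite /cdiff !sum4 !mxE /cpartial.
rewrite !(partial_eq (Dr _)) !(partial_eq (Di _)).
by apply/eqP; rewrite eq_complex /=; apply/andP; split; apply/eqP; ring.
Qed.

Lemma dbrane_p1 x X : c_p1 (dbrane K x X) = (- (X 1 0 / c)) +i* (- (X 0 0 / c)).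
Proof.
have Dr v : is_derive x v (fun y : V => complex.Re (c_p1 (brane K y))) (- (v 1 0 / c)).
  under eq_fun do rewrite brane_p1//=.
  by derive_by; rewrite /=; ring.
have Di v : is_derive x v (fun y : V => complex.Im (c_p1 (brane K y))) (- (v 0 0 / c)).
  under eq_fun do rewrite brane_p1//=.
  by derive_by; rewrite /=; ring.
rewrite [LHS](cdiff_cvec X Dr Di) !sum4 !mxE /=.
by apply/eqP; rewrite eq_complex /=; apply/andP; split; apply/eqP; ring.
Qed.

Lemma dbrane_p2 x X : c_p2 (dbrane K x X) =
  (- (X 3 0 * lnq 0 (nsq2 x) + x 3 0 * (lnq 1 (nsq2 x) * dnsq2 x X))) +i*
  (- (X 2 0 * lnq 0 (nsq2 x) + x 2 0 * (lnq 1 (nsq2 x) * dnsq2 x X))).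
Proof.
have Dr v : is_derive x v (fun y : V => complex.Re (c_p2 (brane K y)))
    (- (v 3 0 * lnq 0 (nsq2 x) + x 3 0 * (lnq 1 (nsq2 x) * dnsq2 x v))).
  under eq_fun do rewrite brane_p2//=.
  by derive_by.
have Di v : is_derive x v (fun y : V => complex.Im (c_p2 (brane K y)))
    (- (v 2 0 * lnq 0 (nsq2 x) + x 2 0 * (lnq 1 (nsq2 x) * dnsq2 x v))).
  under eq_fun do rewrite brane_p2//=.
  by derive_by.
rewrite [LHS](cdiff_cvec X Dr Di) !sum4 /dnsq2 !mxE /=.
by apply/eqP; rewrite eq_complex /=; apply/andP; split; apply/eqP; ring.
Qed.

Lemma dbrane_q1 x X : c_q1 (dbrane K x X) = q1 X.
Proof.
have D i v := is_derive_coord x v i.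
rewrite [LHS](cdiff_cvec (f := @q1 R) X (D 0) (D 1)) !sum4 !mxE /= /q1.
by apply/eqP; rewrite eq_complex /=; apply/andP; split; apply/eqP; ring.
Qed.

Lemma dbrane_q2 x X : c_q2 (dbrane K x X) = q2 X.
Proof.
have D i v := is_derive_coord x v i.
rewrite [LHS](cdiff_cvec (f := @q2 R) X (D 2) (D 3)) !sum4 !mxE /= /q2.
by apply/eqP; rewrite eq_complex /=; apply/andP; split; apply/eqP; ring.
Qed.

(** The [q2] part collects [lnq 0 + |q2|^2 lnq 1], which [lnq1E] turns into [1 / (1 + |q2|^2)]. The
    imaginary part cancels, so the real part taken in [FL] is the whole form. *)
Lemma OmegaLE x X Y : OmegaL K x X Y =
  (2 / c * (X 0 0 * Y 1 0 - X 1 0 * Y 0 0) +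
   2 * (1 + nsq2 x)^-1 * (X 2 0 * Y 3 0 - X 3 0 * Y 2 0))%:C.
Proof.
rewrite /OmegaL /Omega !dbrane_p1 !dbrane_p2 !dbrane_q1 !dbrane_q2.
rewrite -(lnq1E (nsq2_ge0 x)) /dnsq2.
set l0 := lnq 0 _; set l1 := lnq 1 _; rewrite /nsq2.
by apply/eqP; rewrite eq_complex /=; apply/andP; split; apply/eqP; ring.
Qed.

Lemma FLE : FL K = F_mx c.
Proof.
apply/funext => x; apply: eq_mx4 => i j; rewrite mxE OmegaLE /=; move: i j.
by apply: forall4; apply: forall4; rewrite !mxE /=; ring.
Qed.

Lemma OmegaL_bil x X Y : OmegaL K x X Y = (bil (FL K x) X Y)%:C.
Proof.
rewrite OmegaLE FLE /bil; congr (_%:C).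
by rewrite !mxE ?sum4 !mxE ?sum4 !mxE /=; ring.
Qed.

Lemma OmegaL_ddbar x X Y : OmegaL K x X Y = i_ddbar K x X Y.
Proof.
have -> : i_ddbar K x X Y = 'i * ((c^-1)%:C * wedge (@dq1 R) (@dq1bar R) X Y
    + 0 * wedge (@dq1 R) (@dq2bar R) X Y + 0 * wedge (@dq2 R) (@dq1bar R) X Y
    + ((1 + nsq2 x)^-1)%:C * wedge (@dq2 R) (@dq2bar R) X Y).
  congr ('i * (_ * _ + _ * _ + _ * _ + _ * _)).
  - exact: d_q1q1barK.
  - exact: d_q1q2barK.
  - exact: d_q2q1barK.
  - exact: d_q2q2barK.
rewrite OmegaLE /wedge /dq1 /dq1bar /dq2 /dq2bar /q1 /q2.
by apply/eqP; rewrite eq_complex /=; apply/andP; split; apply/eqP; ring.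
Qed.

Lemma bil_g_mx x X Y : bil (g_mx c x) X Y =
  2 / c * (X 0 0 * Y 0 0 + X 1 0 * Y 1 0) +
  2 * (1 + nsq2 x)^-1 * (X 2 0 * Y 2 0 + X 3 0 * Y 3 0) +
  2 / c * (1 + nsq2 x)^-1 *
    (x 3 0 * (X 0 0 * Y 2 0 + X 2 0 * Y 0 0 - X 1 0 * Y 3 0 - X 3 0 * Y 1 0) -
     x 2 0 * (X 0 0 * Y 3 0 + X 3 0 * Y 0 0 + X 1 0 * Y 2 0 + X 2 0 * Y 1 0)).
Proof. by rewrite /bil !mxE ?sum4 !mxE ?sum4 !mxE /=; ring. Qed.

Lemma bil_metric_formula x X Y : (bil (g_mx c x) X Y)%:C = metric_formula c x X Y.
Proof.
rewrite bil_g_mx /metric_formula /symprod half_complex -fmorphV.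
rewrite -[nsq (q2 x)]/(nsq2 x) /dq1 /dq1bar /dq2 /dq2bar /q1 /q2.
by apply/eqP; rewrite eq_complex /=; apply/andP; split; apply/eqP; field;
  rewrite ?c0 ?nsq2_neq0.
Qed.

End BraneForm.

(** * Torsion and integrability *)

Section SkewForms.
Variable R : realType.
Local Notation V := 'cV[R]_4.
Local Notation VC := 'cV[R[i]]_4.

(* The matrix of the 2-form [\sum_(k < l) p_kl dx_k /\ dx_l]. *)
Definition sk (p01 p02 p03 p12 p13 p23 : R) : 'M[R]_4 := mx4
  [:: [:: 0; - p01; - p02; - p03]; [:: p01; 0; - p12; - p13];
      [:: p02; p12; 0; - p23]; [:: p03; p13; p23; 0]].

Lemma sk_trmx p01 p02 p03 p12 p13 p23 :
  (sk p01 p02 p03 p12 p13 p23)^T = - sk p01 p02 p03 p12 p13 p23.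
Proof. by mx4_entries; rewrite ?oppr0 ?opprK. Qed.

(** The 3-form [dx_i /\ dx_j /\ dx_k]; indices 0, 1, 2, 3 stand for the real and imaginary parts of
    [q1], then of [q2]. *)
Definition det3 (i j k : 'I_4) (u0 u1 u2 : VC) : R[i] :=
  u0 i 0 * (u1 j 0 * u2 k 0 - u1 k 0 * u2 j 0) -
  u0 j 0 * (u1 i 0 * u2 k 0 - u1 k 0 * u2 i 0) +
  u0 k 0 * (u1 i 0 * u2 j 0 - u1 j 0 * u2 i 0).

(** For coefficients that depend on [q2] only, the differential is a pair of numbers. *)
Definition dq2_derive (f : V -> R) (x : V) (a b : R) : Prop :=
  forall v, is_derive x v f (a * v 2 0 + b * v 3 0).

Lemma bilC_sk p01 p02 p03 p12 p13 p23 (u w : VC) :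
  bilC (map_mx (real_complex R) (sk p01 p02 p03 p12 p13 p23)) u w =
  p01%:C * (u 0 0 * w 1 0 - u 1 0 * w 0 0) + p02%:C * (u 0 0 * w 2 0 - u 2 0 * w 0 0) +
  p03%:C * (u 0 0 * w 3 0 - u 3 0 * w 0 0) + p12%:C * (u 1 0 * w 2 0 - u 2 0 * w 1 0) +
  p13%:C * (u 1 0 * w 3 0 - u 3 0 * w 1 0) + p23%:C * (u 2 0 * w 3 0 - u 3 0 * w 2 0).
Proof. by rewrite bilCE !sum4 !mxE /=; ring. Qed.

(** Since differentials of coefficients lie in the span of [dx_2] and [dx_3], the coefficient [p23]
    drops out, and [p02] and [p03] meet with opposite signs in the single term
    [dx_0 /\ dx_2 /\ dx_3]; likewise for [p12] and [p13]. *)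
Lemma extd_sk (p01 p02 p03 p12 p13 p23 : V -> R) x
    a01 b01 a02 b02 a03 b03 a12 b12 a13 b13 a23 b23 v :
  dq2_derive p01 x a01 b01 -> dq2_derive p02 x a02 b02 ->
  dq2_derive p03 x a03 b03 -> dq2_derive p12 x a12 b12 ->
  dq2_derive p13 x a13 b13 -> dq2_derive p23 x a23 b23 ->
  extd (form2 (fun y => sk (p01 y) (p02 y) (p03 y) (p12 y) (p13 y) (p23 y))) x v =
  a01%:C * det3 0 1 2 (v 0) (v 1) (v 2) + b01%:C * det3 0 1 3 (v 0) (v 1) (v 2) +
  (b02 - a03)%:C * det3 0 2 3 (v 0) (v 1) (v 2) +
  (b12 - a13)%:C * det3 1 2 3 (v 0) (v 1) (v 2).
Proof.
move=> D01 D02 D03 D12 D13 D23.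
pose D (a b : R) (j : 'I_4) : R :=
  a * (delta_mx j 0 : V) 2 0 + b * (delta_mx j 0 : V) 3 0.
have H j k l : is_derive x (delta_mx j 0)
    (fun y => sk (p01 y) (p02 y) (p03 y) (p12 y) (p13 y) (p23 y) k l)
    (sk (D a01 b01 j) (D a02 b02 j) (D a03 b03 j)
        (D a12 b12 j) (D a13 b13 j) (D a23 b23 j) k l).
  move: k l; apply: forall4; apply: forall4; under eq_fun do rewrite mxE /=;
    rewrite mxE /=; (exact: is_derive_cst || exact: is_derive_opp || exact: D01 ||
    exact: D02 || exact: D03 || exact: D12 || exact: D13 || exact: D23).
rewrite (extd_form2 v H).
rewrite /dform2 /dbilC !sum4 !bilC_sk /D !mxE /= /det3.
by ring.
Qed.

(** Here [df] is a combination of [dx_2] and [dx_3], both already factors of the form. This is what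
    gives [dd^c omega = 0]. *)
Lemma extd_det3 (f : V -> R) (x : V) a b v : dq2_derive f x a b ->
  extd (fun y (w : 'I_3 -> VC) => det3 0 2 3 (w 0) (w 1) (w 2) * (f y)%:C) x v = 0.
Proof.
move=> D; pose df (j : 'I_4) : R :=
  a * (delta_mx j 0 : V) 2 0 + b * (delta_mx j 0 : V) 3 0.
pose dt (i : 'I_4) := det3 0 2 3 (v (lift i 0)) (v (lift i 1)) (v (lift i 2)).
have E (i : 'I_4) : cdiff (fun y => dt i * (f y)%:C) x (v i) =
    \sum_j v i j 0 * (dt i * (df j)%:C).
  by apply: cdiffE => j; exact: is_cpartial_scale.
rewrite /extd; under eq_bigr => i _ do rewrite -/(dt i) E.
rewrite !sum4 /dt.
have l0 : [/\ lift (0 : 'I_4) (0 : 'I_3) = 1,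
    lift (0 : 'I_4) (1 : 'I_3) = 2 & lift (0 : 'I_4) (2 : 'I_3) = 3].
  by split; apply: val_inj.
have l1 : [/\ lift (1 : 'I_4) (0 : 'I_3) = 0,
    lift (1 : 'I_4) (1 : 'I_3) = 2 & lift (1 : 'I_4) (2 : 'I_3) = 3].
  by split; apply: val_inj.
have l2 : [/\ lift (2 : 'I_4) (0 : 'I_3) = 0,
    lift (2 : 'I_4) (1 : 'I_3) = 1 & lift (2 : 'I_4) (2 : 'I_3) = 3].
  by split; apply: val_inj.
have l3 : [/\ lift (3 : 'I_4) (0 : 'I_3) = 0,
    lift (3 : 'I_4) (1 : 'I_3) = 1 & lift (3 : 'I_4) (2 : 'I_3) = 2].
  by split; apply: val_inj.
case: l0 => -> -> ->; case: l1 => -> -> ->; case: l2 => -> -> ->; case: l3 => -> -> ->.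
rewrite /df !mxE /= /det3.
move: (v 0) (v 1) (v 2) (v 3) => v0 v1 v2 v3.
have [-> -> -> ->] : [/\ (-1) ^+ nat_of_ord (0 : 'I_4) = 1 :> R[i],
  (-1) ^+ nat_of_ord (1 : 'I_4) = -1 :> R[i],
  (-1) ^+ nat_of_ord (2 : 'I_4) = 1 :> R[i] & (-1) ^+ nat_of_ord (3 : 'I_4) = -1 :> R[i]].
  by split; ring.
by ring.
Qed.

End SkewForms.

(** * Algebraic relations between the metric, the forms and the complex structures *)

Section Products.
Variables (R : realType) (c : R).
Local Notation V := 'cV[R]_4.
Local Notation VC := 'cV[R[i]]_4.
Implicit Types x X : V.

Local Notation h x := (1 + nsq2 x)^-1.

(* [x_2^2 h + x_3^2 h = 1 - h], oriented for use with [ring]. *)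
Lemma inv_nsq2_rel x : x 2 0 ^+ 2 * h x = 1 - h x - x 3 0 ^+ 2 * h x.
Proof.
have E : nsq2 x * h x = 1 - h x by field; exact: nsq2_neq0.
by rewrite -E; set k := _^-1; rewrite /nsq2; ring.
Qed.

Definition omegap x : 'M[R]_4 := sk (2 / c - 4 / c / c + 4 / c / c * h x)
  (2 / c * (x 2 0 * h x)) (2 / c * (x 3 0 * h x)) (2 / c * (x 3 0 * h x))
  (- (2 / c * (x 2 0 * h x))) (2 * h x).

Definition omegam x : 'M[R]_4 := sk (2 / c)
  (- (2 / c * (x 2 0 * h x))) (- (2 / c * (x 3 0 * h x))) (- (2 / c * (x 3 0 * h x)))
  (2 / c * (x 2 0 * h x)) (2 * h x - 4 / c * (h x - h x * h x)).

Lemma F_mxE : F_mx c = fun x => sk (2 / c) 0 0 0 0 (2 * h x).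
Proof. by apply/funext => x; mx4_entries; rewrite ?oppr0. Qed.

Lemma b_mxE : b_mx c = fun x => sk 0 (2 / c * (x 3 0 * h x)) (- (2 / c * (x 2 0 * h x)))
  (- (2 / c * (x 2 0 * h x))) (- (2 / c * (x 3 0 * h x))) 0.
Proof. by apply/funext => x; mx4_entries; ring. Qed.

Lemma Ip_sqr x : Ip_mx c x *m Ip_mx c x = - 1%:M.
Proof. by mx4_entries; ring. Qed.

Lemma Im_sqr x : Im_mx x *m Im_mx x = - 1%:M.
Proof. by mx4_entries; ring. Qed.

(** Together with [F_mx_Im] this inverts the formulas for [g] and [b]; those formulas and the
    compatibility of [F] then follow by sums, differences and transposes. *)
Lemma F_mx_Ip_mx x : F_mx c x *m Ip_mx c x = - (g_mx c x + b_mx c x).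
Proof. by mx4_entries; ring. Qed.

Lemma F_mx_Im x : F_mx c x *m Im_mx x = - (g_mx c x - b_mx c x).
Proof. by mx4_entries; ring. Qed.

Lemma g_mx_Ip_mx x : g_mx c x *m Ip_mx c x = omegap x.
Proof. by mx4_entries; ring: (inv_nsq2_rel x). Qed.

Lemma g_mx_Im x : g_mx c x *m Im_mx x = omegam x.
Proof. by mx4_entries; ring: (inv_nsq2_rel x). Qed.

Lemma g_mx_trmx x : (g_mx c x)^T = g_mx c x.
Proof. by mx4_entries. Qed.

Lemma b_mx_trmx x : (b_mx c x)^T = - b_mx c x.
Proof. by rewrite b_mxE sk_trmx. Qed.

Lemma F_mx_trmx x : (F_mx c x)^T = - F_mx c x.
Proof. by rewrite F_mxE sk_trmx. Qed.

(** The squares absorb all cross terms between dq1 and dq2. The price is [2 / c * h^2 * |q2|^2 = 2 /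
    c * h * (1 - h)], subtracted from the coefficient [2 * h] of [|dq2|^2]. *)
Lemma bil_g_mx_sum_sqr x X :
  let S1 := X 0 0 + h x * (x 3 0 * X 2 0 - x 2 0 * X 3 0) in
  let S2 := X 1 0 - h x * (x 3 0 * X 3 0 + x 2 0 * X 2 0) in
  bil (g_mx c x) X X = 2 / c * (S1 ^+ 2 + S2 ^+ 2) +
    2 * (h x * (1 - (1 - h x) / c)) * (X 2 0 ^+ 2 + X 3 0 ^+ 2).
Proof. by rewrite bil_g_mx /=; ring: (inv_nsq2_rel x). Qed.

End Products.

(** * Positivity, the Hermitian conditions and the tensor Q *)

Section Positivity.
Variables (R : realType) (c : R).
Hypothesis hc : 1 < c.
Local Notation V := 'cV[R]_4.
Local Notation VC := 'cV[R[i]]_4.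
Implicit Types x X : V.

Let c0 : c != 0.
Proof. by rewrite gt_eqF// (lt_trans ltr01). Qed.

Local Notation h x := (1 + nsq2 x)^-1.

Lemma inv_nsq2_gt0 x : 0 < h x.
Proof. by rewrite invr_gt0 nsq2_gt0. Qed.

Lemma inv_nsq2_le1 x : h x <= 1.
Proof. by rewrite invf_le1 ?nsq2_gt0// lerDl nsq2_ge0. Qed.

Let c_gt0 : 0 < c := lt_trans ltr01 hc.

(** Here [1 < c] matters: as [|q2|] grows, [h] tends to 0 and the weight decreases to [1 - 1 / c],
    which must stay positive. *)
Lemma g_mx_weight x : (c - 1) / c <= 1 - (1 - h x) / c.
Proof.
have -> : 1 - (1 - h x) / c = (c - 1) / c + h x / c by field; rewrite c0 nsq2_neq0.
by rewrite lerDl; apply: divr_ge0; apply: ltW; [exact: inv_nsq2_gt0|].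
Qed.

Lemma g_mx_pos x X : X != 0 -> 0 < bil (g_mx c x) X X.
Proof.
move=> X0; rewrite bil_g_mx_sum_sqr /=.
set S1 := X 0 0 + _; set S2 := X 1 0 - _.
have w0 : 0 < 2 * (h x * (1 - (1 - h x) / c)).
  rewrite mulr_gt0// mulr_gt0 ?inv_nsq2_gt0//; apply: lt_le_trans (g_mx_weight x).
  by rewrite divr_gt0// subr_gt0.
have k0 : 0 < 2 / c by rewrite divr_gt0.
have s0 : 0 <= X 2 0 ^+ 2 + X 3 0 ^+ 2 by rewrite addr_ge0 ?sqr_ge0.
have t0 : 0 <= S1 ^+ 2 + S2 ^+ 2 by rewrite addr_ge0 ?sqr_ge0.
have [a0 b0] : 0 <= 2 / c * (S1 ^+ 2 + S2 ^+ 2) /\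
    0 <= 2 * (h x * (1 - (1 - h x) / c)) * (X 2 0 ^+ 2 + X 3 0 ^+ 2).
  by split; apply: mulr_ge0 => //; exact: ltW.
rewrite lt0r addr_ge0// andbT; apply: contra X0.
rewrite paddr_eq0// (mulf_eq0 (2 / c)) (mulf_eq0 (2 * (_ * _))) (gt_eqF w0) (gt_eqF k0) /=.
rewrite !paddr_eq0 ?sqr_ge0// !sqrf_eq0.
move=> /andP[/andP[/eqP e1 /eqP e2] /andP[/eqP e3 /eqP e4]].
move: e1 e2; rewrite /S1 /S2 e3 e4 !mulr0 subr0 addr0 mulr0 addr0 subr0 => e1 e2.
by apply/eqP/col4P; rewrite !mxE.
Qed.

Lemma posdef_unitmx n (A : 'M[R]_n.+1) :
  (forall X : 'cV_n.+1, X != 0 -> 0 < bil A X X) -> A \in unitmx.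
Proof.
move=> Apos; rewrite -row_free_unit -kermx_eq0; apply/rowV0P => v /sub_kermxP vA.
apply/eqP; apply: contraT => v0.
have /Apos : v^T != 0 by rewrite -(inj_eq (can_inj (@trmxK _ _ _))) trmxK trmx0.
by rewrite /bil trmxK vA mul0mx mxE ltxx.
Qed.

Lemma g_mx_unit x : g_mx c x \in unitmx.
Proof. by apply: posdef_unitmx => X; exact: g_mx_pos. Qed.

Lemma F_mx_unit x : F_mx c x \in unitmx.
Proof.
have FF : F_mx c x *m mx4 [:: [:: 0; c / 2; 0; 0]; [:: - (c / 2); 0; 0; 0];
    [:: 0; 0; 0; (1 + nsq2 x) / 2]; [:: 0; 0; - ((1 + nsq2 x) / 2); 0]] = 1%:M.
  by mx4_entries; field; rewrite ?c0 ?nsq2_neq0.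
by have [] := mulmx1_unit FF.
Qed.

(** The skewness of [g *m I] is visible from the shape [sk] of [omegap] and [omegam], so the
    Hermitian conditions need no further expansion. *)
Lemma hermitian_skew n (g I : 'M[R]_n.+1) : g^T = g -> I *m I = - 1%:M ->
  (g *m I)^T = - (g *m I) -> I^T *m g *m I = g.
Proof.
move=> gT I2; rewrite trmx_mul gT => ->.
by rewrite mulNmx -mulmxA I2 mulmxN mulmx1 opprK.
Qed.

Lemma hermitian_p x : (Ip_mx c x)^T *m g_mx c x *m Ip_mx c x = g_mx c x.
Proof. by apply: hermitian_skew; rewrite ?g_mx_trmx ?Ip_sqr ?g_mx_Ip_mx ?sk_trmx. Qed.

Lemma hermitian_m x : (Im_mx x)^T *m g_mx c x *m Im_mx x = g_mx c x.
Proof. by apply: hermitian_skew; rewrite ?g_mx_trmx ?Im_sqr ?g_mx_Im ?sk_trmx. Qed.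

(** The second term is minus the transpose of [F I_-], that is [(g - b)^T = g + b], and it cancels
    [F I_+ = - (g + b)]. *)
Lemma Fmx_compat x : F_mx c x *m Ip_mx c x + (Im_mx x)^T *m F_mx c x = 0.
Proof.
rewrite F_mx_Ip_mx -[_^T *m _]trmxK trmx_mul trmxK F_mx_trmx mulNmx F_mx_Im opprK.
by rewrite linearB /= g_mx_trmx b_mx_trmx opprK addNr.
Qed.

Lemma metric_ofE x : - 2^-1 *: (F_mx c x *m (Ip_mx c x + Im_mx x)) = g_mx c x.
Proof.
rewrite mulmxDr F_mx_Ip_mx F_mx_Im -opprD scaleNr scalerN opprK addrACA subrr addr0.
rewrite -(mulr2n (g_mx c x)) -(scaler_nat 2 (g_mx c x)) scalerA.
by rewrite mulVf ?scale1r// pnatr_eq0.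
Qed.

Lemma bfield_ofE x : - 2^-1 *: (F_mx c x *m (Ip_mx c x - Im_mx x)) = b_mx c x.
Proof.
rewrite mulmxBr F_mx_Ip_mx F_mx_Im opprK scaleNr -scalerN opprD !opprK.
rewrite opprB (addrC (b_mx c x) (- _)) addrACA subrr add0r.
rewrite -(mulr2n (b_mx c x)) -(scaler_nat 2 (b_mx c x)) scalerA.
by rewrite mulVf ?scale1r// pnatr_eq0.
Qed.

(** The relation is checked after right multiplication by [I_+ + I_-], which is invertible because
    [F (I_+ + I_-) = -2 g]. On the left the squares cancel and the commutator [I_+ I_- - I_- I_+]
    remains; on the right [g] cancels its inverse in [Q]. *)
Lemma Ip_sub_Im x :
  Ip_mx c x - Im_mx x = Qmx (g_mx c) (Ip_mx c) (@Im_mx R) x *m F_mx c x.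
Proof.
have n2 : - 2^-1 != 0 :> R by rewrite oppr_eq0 invr_eq0 pnatr_eq0.
have S0 : Ip_mx c x + Im_mx x \in unitmx.
  have := g_mx_unit x; rewrite -metric_ofE unitmxZ ?unitfE//.
  by rewrite unitmx_mul => /andP[].
have FS : F_mx c x *m (Ip_mx c x + Im_mx x) = - 2 *: g_mx c x.
  by rewrite -metric_ofE scalerA mulrNN mulfV ?scale1r// pnatr_eq0.
apply: (can_inj (mulmxK S0)).
rewrite /Qmx -scalemxAl -scalemxAl -!mulmxA FS -scalemxAr mulVmx ?g_mx_unit//.
rewrite -scalemxAr mulmx1 scalerA mulrN mulVf ?pnatr_eq0// scaleN1r opprB.
rewrite mulmxDr !mulmxBl Ip_sqr Im_sqr opprK.
by rewrite addrC -addrA addNKr.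
Qed.
End Positivity.

(** * Exterior derivatives of F, b and the fundamental forms *)

Section ExteriorDerivatives.
Variables (R : realType) (c : R).
Local Notation V := 'cV[R]_4.
Local Notation VC := 'cV[R[i]]_4.
Implicit Types x X : V.

Local Notation h x := (1 + nsq2 x)^-1.

Lemma dq2_derive_h x : dq2_derive (fun y : V => h y) x
  (- (2 * x 2 0 * (h x * h x))) (- (2 * x 3 0 * (h x * h x))).
Proof. by move=> v; derive_by; rewrite /= /dnsq2; ring. Qed.

Lemma dq2_derive_cst (a : R) x : dq2_derive (fun y : V => a) x 0 0.
Proof.
by move=> v; apply: (is_derive_eq (is_derive_cst (a : R) x v)); rewrite !mul0r addr0.
Qed.

Lemma dq2_derive_x2h x : dq2_derive (fun y : V => y 2 0 * h y) x
  (h x - 2 * x 2 0 ^+ 2 * (h x * h x)) (- (2 * x 2 0 * x 3 0 * (h x * h x))).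
Proof. by move=> v; derive_by; rewrite /= /dnsq2; ring. Qed.

Lemma dq2_derive_x3h x : dq2_derive (fun y : V => y 3 0 * h y) x
  (- (2 * x 2 0 * x 3 0 * (h x * h x))) (h x - 2 * x 3 0 ^+ 2 * (h x * h x)).
Proof. by move=> v; derive_by; rewrite /= /dnsq2; ring. Qed.

Lemma dq2_deriveZ (k : R) (f : V -> R) x a b :
  dq2_derive f x a b -> dq2_derive (fun y => k * f y) x (k * a) (k * b).
Proof.
move=> D v; have D1 := is_derive_mul (is_derive_cst (k : R) x v) (D v).
by apply: (is_derive_eq D1) => /=; ring.
Qed.

Lemma dq2_deriveN (f : V -> R) x a b :
  dq2_derive f x a b -> dq2_derive (fun y => - f y) x (- a) (- b).
Proof.
by move=> D v; apply: (is_derive_eq (is_derive_opp (D v))); ring.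
Qed.

Lemma dq2_deriveD (f g : V -> R) x a b a' b' : dq2_derive f x a b ->
  dq2_derive g x a' b' -> dq2_derive (fun y => f y + g y) x (a + a') (b + b').
Proof.
by move=> D D' v; apply: (is_derive_eq (is_derive_add (D v) (D' v))); ring.
Qed.

Lemma dq2_derive_h2 x : dq2_derive (fun y : V => h y * h y) x
  (- (4 * x 2 0 * (h x * h x * h x))) (- (4 * x 3 0 * (h x * h x * h x))).
Proof. by move=> v; derive_by; rewrite /= /dnsq2; ring. Qed.

Local Notation det i j k v := (det3 i j k (v 0) (v 1) (v 2)).

Lemma extd_F_mx x v : extd (form2 (F_mx c)) x v = 0.
Proof.
rewrite F_mxE (extd_sk v (dq2_derive_cst _ x) (dq2_derive_cst _ x) (dq2_derive_cst _ x)
  (dq2_derive_cst _ x) (dq2_derive_cst _ x) (dq2_deriveZ 2 (dq2_derive_h x))).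
by ring.
Qed.

Lemma extd_b_mx x v :
  extd (form2 (b_mx c)) x v = det 0 2 3 v * (4 / c * (h x * h x))%:C.
Proof.
have D2 := dq2_deriveZ (2 / c) (dq2_derive_x2h x).
have D3 := dq2_deriveZ (2 / c) (dq2_derive_x3h x).
rewrite b_mxE (extd_sk v (dq2_derive_cst _ x) D3 (dq2_deriveN D2) (dq2_deriveN D2)
  (dq2_deriveN D3) (dq2_derive_cst _ x)).
(* The divergence of [q2 * h] in the plane is [2 * h - 2 * |q2|^2 * h^2], equal to [2 * h^2] by
   [|q2|^2 * h = 1 - h]. *)
rewrite (_ : 2 / c * _ - _ = 4 / c * (h x * h x)); last by ring: (inv_nsq2_rel x).
rewrite (_ : - _ - _ = 0); last by ring.
by ring.
Qed.

Lemma extd_omegap x v : extd (form2 (omegap c)) x v =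
  (4 / c * (h x * h x))%:C * det 1 2 3 v
  - (8 / c / c * x 2 0 * (h x * h x))%:C * det 0 1 2 v
  - (8 / c / c * x 3 0 * (h x * h x))%:C * det 0 1 3 v.
Proof.
have D2 := dq2_deriveZ (2 / c) (dq2_derive_x2h x).
have D3 := dq2_deriveZ (2 / c) (dq2_derive_x3h x).
have D1 := dq2_deriveD (dq2_derive_cst (2 / c - 4 / c / c) x)
  (dq2_deriveZ (4 / c / c) (dq2_derive_h x)).
have D23 := dq2_deriveZ 2 (dq2_derive_h x).
rewrite [omegap c](_ : _ = fun x => omegap c x)// /omegap
  (extd_sk v D1 D2 D3 D3 (dq2_deriveN D2) D23).
rewrite (_ : 2 / c * _ - 2 / c * _ = 0); last by ring.
rewrite (_ : 2 / c * _ - - (2 / c * _) = 4 / c * (h x * h x));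
  last by ring: (inv_nsq2_rel x).
by ring.
Qed.

Lemma extd_omegam x v : extd (form2 (omegam c)) x v =
  - (4 / c * (h x * h x))%:C * det 1 2 3 v.
Proof.
have D2 := dq2_deriveZ (2 / c) (dq2_derive_x2h x).
have D3 := dq2_deriveZ (2 / c) (dq2_derive_x3h x).
have D23 := dq2_deriveD (dq2_deriveZ 2 (dq2_derive_h x))
  (dq2_deriveN (dq2_deriveZ (4 / c) (dq2_deriveD (dq2_derive_h x)
    (dq2_deriveN (dq2_derive_h2 x))))).
rewrite [omegam c](_ : _ = fun x => omegam c x)// /omegam
  (extd_sk v (dq2_derive_cst _ x)
  (dq2_deriveN D2) (dq2_deriveN D3) (dq2_deriveN D3) D2 D23).
rewrite (_ : - _ - - (2 / c * _) = 0); last by ring.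
rewrite (_ : - (2 / c * _) - 2 / c * _ = - (4 / c * (h x * h x)));
  last by ring: (inv_nsq2_rel x).
by ring.
Qed.

End ExteriorDerivatives.

(** * The forms d^c omega and the Nijenhuis tensors *)

Section Torsion.
Variables (R : realType) (c : R).
Hypothesis hc : 1 < c.
Local Notation V := 'cV[R]_4.
Local Notation VC := 'cV[R[i]]_4.
Implicit Types x X : V.

Local Notation h x := (1 + nsq2 x)^-1.
Local Notation det i j k v := (det3 i j k (v 0) (v 1) (v 2)).

Lemma det3_trilinear i j k : trilinear (@det3 R i j k).
Proof. by split=> a b u u' w t; rewrite /det3 !mxE; ring. Qed.

Lemma trilinear_comb (T1 T2 T3 : VC -> VC -> VC -> R[i]) (k1 k2 k3 : R[i]) :
  trilinear T1 -> trilinear T2 -> trilinear T3 ->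
  trilinear (fun u w t => k1 * T1 u w t - k2 * T2 u w t - k3 * T3 u w t).
Proof.
by move=> [a1 b1 d1] [a2 b2 d2] [a3 b3 d3]; split=> a b u u' w t;
  rewrite ?a1 ?a2 ?a3 ?b1 ?b2 ?b3 ?d1 ?d2 ?d3; ring.
Qed.

Lemma omegap_type11 x : (Ip_mx c x)^T *m omegap c x *m Ip_mx c x = omegap c x.
Proof. by rewrite -g_mx_Ip_mx mulmxA hermitian_p. Qed.

Lemma omegam_type11 x : (Im_mx x)^T *m omegam c x *m Im_mx x = omegam c x.
Proof. by rewrite -g_mx_Im mulmxA hermitian_m. Qed.

Lemma Ip_mulmx x (u : VC) : let w := map_mx (real_complex R) (Ip_mx c x) *m u in
  [/\ w 0 0 = - u 1 0, w 1 0 = u 0 0,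
      w 2 0 = (2 / c * x 2 0)%:C * u 0 0 + (2 / c * x 3 0)%:C * u 1 0 - u 3 0 &
      w 3 0 = (2 / c * x 3 0)%:C * u 0 0 - (2 / c * x 2 0)%:C * u 1 0 + u 2 0].
Proof. by split; rewrite !mxE sum4 !mxE /=; ring. Qed.

Lemma Im_mulmx x (u : VC) : let w := map_mx (real_complex R) (Im_mx x) *m u in
  [/\ w 0 0 = - u 1 0 + (2 * x 2 0 * h x)%:C * u 2 0 + (2 * x 3 0 * h x)%:C * u 3 0,
      w 1 0 = u 0 0 + (2 * x 3 0 * h x)%:C * u 2 0 - (2 * x 2 0 * h x)%:C * u 3 0,
      w 2 0 = - u 3 0 & w 3 0 = u 2 0].
Proof. by split; rewrite !mxE sum4 !mxE /=; ring. Qed.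

(** The [8 / c / c] terms of [extd_omegap] cancel against those that the lower-left block of [I_+]
    creates from [det 1 2 3]; only [det 0 2 3] remains. *)
Lemma dc_omegap x v : dc (Ip_mx c) (form2 (omegap c)) x v =
  det 0 2 3 v * (- (4 / c * (h x * h x)))%:C.
Proof.
have := dc_form11E (@Ip_sqr R c) omegap_type11 v
  (trilinear_comb (4 / c * (h x * h x))%:C (8 / c / c * x 2 0 * (h x * h x))%:C
     (8 / c / c * x 3 0 * (h x * h x))%:C
     (det3_trilinear 1 2 3) (det3_trilinear 0 1 2) (det3_trilinear 0 1 3))
  (extd_omegap c x).
move: (dc _ _ _ _) => d /=.
have [] := Ip_mulmx x (v 0); have [] := Ip_mulmx x (v 1); have [] := Ip_mulmx x (v 2).
move: (v 0) (v 1) (v 2) => v0 v1 v2.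
move: (_ *m v0) (_ *m v1) (_ *m v2) => w0 w1 w2.
rewrite /det3 => -> -> -> -> -> -> -> -> -> -> -> -> E.
apply: (@mulfI _ (- 4)); first by rewrite oppr_eq0 pnatr_eq0.
by rewrite E; move: (h x) => k; ring.
Qed.

Lemma dc_omegam x v : dc (@Im_mx R) (form2 (omegam c)) x v =
  det 0 2 3 v * (4 / c * (h x * h x))%:C.
Proof.
have T0 : trilinear (fun (u w t : VC) => - (4 / c * (h x * h x))%:C * det3 1 2 3 u w t).
  have [a1 b1 d1] := det3_trilinear 1 2 3.
  by split=> a b u u' w t; rewrite ?a1 ?b1 ?d1; ring.
have := dc_form11E (@Im_sqr R) omegam_type11 v T0 (extd_omegam c x).
move: (dc _ _ _ _) => d /=.
have [_] := Im_mulmx x (v 0); have [_] := Im_mulmx x (v 1); have [_] := Im_mulmx x (v 2).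
move: (v 0) (v 1) (v 2) => v0 v1 v2.
move: (_ *m v0) (_ *m v1) (_ *m v2) => w0 w1 w2.
rewrite /det3 => -> -> -> -> -> -> -> -> -> E.
apply: (@mulfI _ (- 4)); first by rewrite oppr_eq0 pnatr_eq0.
by rewrite E; move: (h x) => k; ring.
Qed.

Definition dIp (X : V) : 'M[R]_4 := mx4
  [:: [:: 0; 0; 0; 0]; [:: 0; 0; 0; 0];
      [:: 2 / c * X 2 0; 2 / c * X 3 0; 0; 0];
      [:: 2 / c * X 3 0; - (2 / c * X 2 0); 0; 0]].

Definition dx2h x X := X 2 0 * h x - x 2 0 * dnsq2 x X * (h x * h x).
Definition dx3h x X := X 3 0 * h x - x 3 0 * dnsq2 x X * (h x * h x).

Definition dIm x (X : V) : 'M[R]_4 := mx4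
  [:: [:: 0; 0; 2 * dx2h x X; 2 * dx3h x X];
      [:: 0; 0; 2 * dx3h x X; - (2 * dx2h x X)];
      [:: 0; 0; 0; 0]; [:: 0; 0; 0; 0]].

Lemma dmxE (A : V -> 'M[R]_4) (dA : V -> 'M[R]_4) x X :
  (forall v i j, is_derive x v (fun y => A y i j) (dA v i j)) ->
  dmx A x X = \matrix_(i, j) \sum_l X l 0 * dA (delta_mx l 0) i j.
Proof.
move=> D; apply/matrixP => i j; rewrite !mxE; apply: eq_bigr => l _.
by rewrite (partial_eq (D _ _ _)).
Qed.

Lemma dmx_Ip_mx x X : dmx (Ip_mx c) x X = dIp X.
Proof.
have D v i j : is_derive x v (fun y => Ip_mx c y i j) (dIp v i j).
  move: i j; apply: forall4; apply: forall4; under eq_fun do rewrite mxE /=;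
    rewrite mxE /=; (exact: is_derive_cst || (derive_by; rewrite /=; ring)).
by rewrite (dmxE X D); mx4_entries; ring.
Qed.

Lemma dmx_Im x X : dmx (@Im_mx R) x X = dIm x X.
Proof.
have D v i j : is_derive x v (fun y => Im_mx y i j) (dIm x v i j).
  move: i j; apply: forall4; apply: forall4; under eq_fun do rewrite mxE /=;
    rewrite mxE /= /dx2h /dx3h; (exact: is_derive_cst || (derive_by; rewrite /=; ring)).
by rewrite (dmxE X D); mx4_entries; rewrite /dx2h /dx3h /dnsq2 ?mxE /=; ring.
Qed.

Lemma mul_mx4_cV a00 a01 a02 a03 a10 a11 a12 a13 a20 a21 a22 a23
    a30 a31 a32 a33 (u : V) :
  mx4 [:: [:: a00; a01; a02; a03]; [:: a10; a11; a12; a13];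
          [:: a20; a21; a22; a23]; [:: a30; a31; a32; a33]] *m u =
  col4 [:: a00 * u 0 0 + a01 * u 1 0 + a02 * u 2 0 + a03 * u 3 0;
           a10 * u 0 0 + a11 * u 1 0 + a12 * u 2 0 + a13 * u 3 0;
           a20 * u 0 0 + a21 * u 1 0 + a22 * u 2 0 + a23 * u 3 0;
           a30 * u 0 0 + a31 * u 1 0 + a32 * u 2 0 + a33 * u 3 0].
Proof. by apply: col4P; split; rewrite !mxE sum4 !mxE. Qed.

Lemma col4E (a0 a1 a2 a3 : R) : let u := col4 [:: a0; a1; a2; a3] in
  ((u 0 0 = a0) * (u 1 0 = a1) * (u 2 0 = a2) * (u 3 0 = a3))%type.
Proof. by rewrite /= !mxE. Qed.

Lemma nijenhuis_Ip_mx x X Y : nijenhuis (Ip_mx c) x X Y = 0.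
Proof.
rewrite /nijenhuis !dmx_Ip_mx /Ip_mx /dIp !mul_mx4_cV !col4E.
by apply: col4P; split; rewrite !mxE /=; ring.
Qed.

Lemma nijenhuis_Im x X Y : nijenhuis (@Im_mx R) x X Y = 0.
Proof.
rewrite /nijenhuis !dmx_Im /Im_mx /dIm !mul_mx4_cV /dx2h /dx3h /dnsq2 !col4E.
by apply: col4P; split; rewrite !mxE /=; ring: (inv_nsq2_rel x).
Qed.

End Torsion.

Section GeneralizedKahlerData.
Variables (R : realType) (c : R).
Hypothesis hc : 1 < c.
Local Notation V := 'cV[R]_4.
Local Notation VC := 'cV[R[i]]_4.
Implicit Types x X : V.

Local Notation h x := (1 + nsq2 x)^-1.
Local Notation det i j k v := (det3 i j k (v 0) (v 1) (v 2)).
Ltac smooth_mx_by := apply: forall4; apply: forall4;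
  under eq_fun do rewrite mxE /=; rewrite -/(smooth _); smooth_by.

Lemma smooth_Ip_mx : smooth_mx (Ip_mx c).
Proof. smooth_mx_by. Qed.
Lemma smooth_Im : smooth_mx (@Im_mx R).
Proof. smooth_mx_by. Qed.
Lemma smooth_F_mx : smooth_mx (F_mx c).
Proof. smooth_mx_by. Qed.
Lemma smooth_g_mx : smooth_mx (g_mx c).
Proof. smooth_mx_by. Qed.
Lemma smooth_b_mx : smooth_mx (b_mx c).
Proof. smooth_mx_by. Qed.

Lemma fundamental_form_p : fundamental_form (g_mx c) (Ip_mx c) = form2 (omegap c).
Proof. by congr form2; apply/funext => x; exact: g_mx_Ip_mx. Qed.

Lemma fundamental_form_m : fundamental_form (g_mx c) (@Im_mx R) = form2 (omegam c).
Proof. by congr form2; apply/funext => x; exact: g_mx_Im. Qed.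

Lemma dq2_derive_dc (k : R) x : dq2_derive (fun y : V => k * (h y * h y)) x
  (k * - (4 * x 2 0 * (h x * h x * h x))) (k * - (4 * x 3 0 * (h x * h x * h x))).
Proof. exact: dq2_deriveZ (dq2_derive_h2 x). Qed.

Lemma gk_data : generalized_kahler (g_mx c) (Ip_mx c) (@Im_mx R) (b_mx c).
Proof.
split.
- by split; [exact: smooth_g_mx|exact: g_mx_trmx|exact: g_mx_pos].
- by split; [exact: smooth_Ip_mx|exact: Ip_sqr|exact: nijenhuis_Ip_mx].
- by split; [exact: smooth_Im|exact: Im_sqr|exact: nijenhuis_Im].
- exact: hermitian_p.
- exact: hermitian_m.
- exact: smooth_b_mx.
- exact: b_mx_trmx.
- move=> x v; rewrite fundamental_form_p fundamental_form_m dc_omegap// dc_omegam//.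
  by rewrite -mulrDr -rmorphD addNr rmorph0 mulr0.
- move=> x v; rewrite fundamental_form_p.
  have -> : dc (Ip_mx c) (form2 (omegap c)) =
      fun y (w : 'I_3 -> VC) => det 0 2 3 w * (- (4 / c) * (h y * h y))%:C.
    by apply/funext => y; apply/funext => w; rewrite dc_omegap// mulNr.
  exact: extd_det3 (dq2_derive_dc _ x).
- move=> x v; rewrite fundamental_form_m.
  have -> : dc (@Im_mx R) (form2 (omegam c)) =
      fun y (w : 'I_3 -> VC) => det 0 2 3 w * (4 / c * (h y * h y))%:C.
    by apply/funext => y; apply/funext => w; rewrite dc_omegam.
  exact: extd_det3 (dq2_derive_dc _ x).
- by move=> x v; rewrite fundamental_form_p dc_omegap// extd_b_mx rmorphN mulrN.
- by move=> x v; rewrite fundamental_form_m dc_omegam// extd_b_mx.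
Qed.

Lemma gk_symplectic_data : gk_symplectic_type (Ip_mx c) (@Im_mx R) (F_mx c).
Proof.
have gE : metric_of (Ip_mx c) (@Im_mx R) (F_mx c) = g_mx c.
  by apply/funext => x; exact: metric_ofE.
have bE : bfield_of (Ip_mx c) (@Im_mx R) (F_mx c) = b_mx c.
  by apply/funext => x; exact: bfield_ofE.
split; rewrite ?gE ?bE.
- exact: gk_data.
- by split; [exact: smooth_F_mx|exact: F_mx_trmx|exact: F_mx_unit|exact: extd_F_mx].
- exact: Ip_sub_Im.
- exact: Fmx_compat.
Qed.
End GeneralizedKahlerData.

(** * Completeness *)

Section MetricBounds.
Variables (R : realType) (c : R).
Hypothesis hc : 1 < c.
Local Notation V := 'cV[R]_4.
Local Notation VC := 'cV[R[i]]_4.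
Implicit Types x X : V.

Let c0 : c != 0.
Proof. by rewrite gt_eqF// (lt_trans ltr01). Qed.

Local Notation h x := (1 + nsq2 x)^-1.

Let c_gt0 : 0 < c := lt_trans ltr01 hc.
Let c1_gt0 : 0 < c - 1. Proof. by rewrite subr_gt0. Qed.

(** The summand [c] undoes the factor [2 / c] of the squares, and [c / (c - 1)] undoes the lower
    bound of [g_mx_weight]. *)
Definition Lip_sq : R := c + c / (c - 1).

Lemma Lip2_ge0 : 0 <= Lip_sq.
Proof. by apply: addr_ge0; [exact: ltW|apply: divr_ge0; exact: ltW]. Qed.

Lemma nsq2_inv_sqr_le x : nsq2 x * (h x * h x) <= h x.
Proof.
have := inv_nsq2_gt0 x; have -> : nsq2 x * (h x * h x) = h x - h x * h x.
  by field; exact: nsq2_neq0.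
by move=> k0; rewrite lerBlDr lerDl mulr_ge0 ?ltW.
Qed.

Lemma g_mx_split x X :
  let S1 := X 0 0 + h x * (x 3 0 * X 2 0 - x 2 0 * X 3 0) in
  let S2 := X 1 0 - h x * (x 3 0 * X 3 0 + x 2 0 * X 2 0) in
  2 * (S1 ^+ 2 + S2 ^+ 2) + 2 * (h x * (X 2 0 ^+ 2 + X 3 0 ^+ 2)) <=
  Lip_sq * bil (g_mx c x) X X.
Proof.
rewrite bil_g_mx_sum_sqr /Lip_sq /=; set S1 := X 0 0 + _; set S2 := X 1 0 - _.
have s0 : 0 <= X 2 0 ^+ 2 + X 3 0 ^+ 2 by rewrite addr_ge0 ?sqr_ge0.
have t0 : 0 <= S1 ^+ 2 + S2 ^+ 2 by rewrite addr_ge0 ?sqr_ge0.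
move: s0 t0 (g_mx_weight hc x) (inv_nsq2_gt0 x).
set s := X 2 0 ^+ 2 + _; set t := S1 ^+ 2 + _; set w := 1 - _ / c; move: (h x) => k.
move: s t w => s t w s0 t0 w0 k0.
have d0 : 0 < c / (c - 1) by exact: divr_gt0.
have wd : 1 <= c / (c - 1) * w.
  rewrite [leLHS](_ : 1 = c / (c - 1) * ((c - 1) / c)); first by rewrite ler_pM2l.
  by field; rewrite c0 gt_eqF.
have w1 : 0 <= w by apply: le_trans w0; apply: divr_ge0; exact: ltW.
have -> : 2 * t = c * (2 / c * t) by field.
have k0' := ltW k0; have ct : 0 <= 2 / c * t.
  by apply: mulr_ge0 => //; apply: divr_ge0 => //; exact: ltW.
have kws : 0 <= 2 * (k * w) * s by rewrite !mulr_ge0.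
have ks : 0 <= 2 * (k * s) by rewrite !mulr_ge0.
rewrite (mulrDl c) lerD//; first by rewrite ler_pM2l// lerDl.
rewrite mulrDr -[leLHS]add0r lerD//; first by rewrite mulr_ge0// ltW.
rewrite [leRHS](_ : _ = 2 * (k * s) * (c / (c - 1) * w)); last by ring.
by rewrite ler_peMr.
Qed.

(** Each component is [S + (X - S)], so its square is at most [2 S^2 + 2 (X - S)^2]; the two
    corrections have squares summing to [|q2|^2 h^2 |dq2|^2], which is at most [h |dq2|^2]. *)
Lemma dx01_le x X : X 0 0 ^+ 2 <= Lip_sq * bil (g_mx c x) X X /\
  X 1 0 ^+ 2 <= Lip_sq * bil (g_mx c x) X X.
Proof.
have := g_mx_split x X; rewrite /=; set S1 := X 0 0 + _; set S2 := X 1 0 - _.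
set Y := X 2 0 ^+ 2 + X 3 0 ^+ 2 => le1.
have Y0 : 0 <= Y by rewrite addr_ge0 ?sqr_ge0.
have k0 := inv_nsq2_gt0 x; have k1 := nsq2_inv_sqr_le x.
have E : (X 0 0 - S1) ^+ 2 + (X 1 0 - S2) ^+ 2 = nsq2 x * (h x * h x) * Y.
  by rewrite /S1 /S2 /Y; move: (h x) => k; rewrite /nsq2; ring.
have le2 : (X 0 0 - S1) ^+ 2 + (X 1 0 - S2) ^+ 2 <= h x * Y by rewrite E ler_wpM2r.
have d1 := sqr_ge0 (X 0 0 - S1 - S1); have d2 := sqr_ge0 (X 1 0 - S2 - S2).
have s1 := sqr_ge0 S1; have s2 := sqr_ge0 S2.
have e1 := sqr_ge0 (X 0 0 - S1); have e2 := sqr_ge0 (X 1 0 - S2).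
have a1 : X 0 0 ^+ 2 =
    2 * S1 ^+ 2 + 2 * (X 0 0 - S1) ^+ 2 - (X 0 0 - S1 - S1) ^+ 2 by ring.
have a2 : X 1 0 ^+ 2 =
    2 * S2 ^+ 2 + 2 * (X 1 0 - S2) ^+ 2 - (X 1 0 - S2 - S2) ^+ 2 by ring.
by split; apply: le_trans le1; [rewrite a1|rewrite a2]; lra.
Qed.

Lemma dx23_le x X : h x * (X 2 0 ^+ 2 + X 3 0 ^+ 2) <= Lip_sq * bil (g_mx c x) X X.
Proof.
apply: le_trans (g_mx_split x X) => /=.
set S1 := X 0 0 + _; set S2 := X 1 0 - _.
have s1 := sqr_ge0 S1; have s2 := sqr_ge0 S2.
have : 0 <= h x * (X 2 0 ^+ 2 + X 3 0 ^+ 2).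
  by rewrite mulr_ge0 ?addr_ge0 ?sqr_ge0// ltW// inv_nsq2_gt0.
lra.
Qed.

(** The estimates give a factor 6; the larger 16 is a perfect square, so that [dist_g_mx_le] has the
    constant 4. *)
Lemma g_mx_le x X : bil (g_mx c x) X X <=
  16 * (`|X 0 0| + `|X 1 0| + `|X 2 0| + `|X 3 0|) ^+ 2.
Proof.
rewrite bil_g_mx_sum_sqr /=; set S1 := X 0 0 + _; set S2 := X 1 0 - _.
set Y := X 2 0 ^+ 2 + X 3 0 ^+ 2.
have Y0 : 0 <= Y by rewrite addr_ge0 ?sqr_ge0.
have k0 := inv_nsq2_gt0 x; have k1 := nsq2_inv_sqr_le x; have kl := inv_nsq2_le1 x.
have E : (X 0 0 - S1) ^+ 2 + (X 1 0 - S2) ^+ 2 = nsq2 x * (h x * h x) * Y.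
  by rewrite /S1 /S2 /Y; move: (h x) => k; rewrite /nsq2; ring.
have le2 : (X 0 0 - S1) ^+ 2 + (X 1 0 - S2) ^+ 2 <= Y.
  rewrite E -[leRHS]mul1r ler_wpM2r//; exact: le_trans kl.
have b1 : 2 / c * (S1 ^+ 2 + S2 ^+ 2) <= 2 * (S1 ^+ 2 + S2 ^+ 2).
  by rewrite ler_wpM2r ?addr_ge0 ?sqr_ge0// ler_pdivrMr// ler_peMr// ltW.
have b2 : 2 * (h x * (1 - (1 - h x) / c)) * Y <= 2 * Y.
  rewrite ler_wpM2r// -[leRHS]mulr1 ler_wpM2l// mulr_ile1 ?(ltW k0)//.
    by apply: le_trans (g_mx_weight hc x); apply: divr_ge0; exact: ltW.
  by rewrite gerDl oppr_le0 divr_ge0 ?subr_ge0// ltW.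
have d1 := sqr_ge0 (X 0 0 + (X 0 0 - S1)); have d2 := sqr_ge0 (X 1 0 + (X 1 0 - S2)).
have n0 := normr_ge0 (X 0 0); have n1 := normr_ge0 (X 1 0).
have n2 := normr_ge0 (X 2 0); have n3 := normr_ge0 (X 3 0).
have c1 : S1 ^+ 2 =
    2 * X 0 0 ^+ 2 + 2 * (X 0 0 - S1) ^+ 2 - (X 0 0 + (X 0 0 - S1)) ^+ 2.
  by ring.
have c2 : S2 ^+ 2 =
    2 * X 1 0 ^+ 2 + 2 * (X 1 0 - S2) ^+ 2 - (X 1 0 + (X 1 0 - S2)) ^+ 2.
  by ring.
have m : X 0 0 ^+ 2 + X 1 0 ^+ 2 + Y <=
    (`|X 0 0| + `|X 1 0| + `|X 2 0| + `|X 3 0|) ^+ 2.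
  rewrite /Y -!(real_normK (num_real (X _ _))); nra.
have q0 := sqr_ge0 (X 0 0); have q1 := sqr_ge0 (X 1 0).
lra.
Qed.
End MetricBounds.

(** * Functions whose differential is bounded by the metric norm *)

Section LipschitzBounds.
Variables (R : realType) (c : R).
Hypothesis hc : 1 < c.
Local Notation V := 'cV[R]_4.
Local Notation VC := 'cV[R[i]]_4.
Implicit Types x X : V.

Local Notation h x := (1 + nsq2 x)^-1.

Let c_gt0 : 0 < c := lt_trans ltr01 hc.

(** The factor 2 comes from [dln_sqr_le] and [dscaled_sqr_le], where 4 appears after squaring; one
    constant then serves all functions. *)
Definition Lip : R := 2 * Num.sqrt (Lip_sq c).

Lemma Lip_sqr : Lip ^+ 2 = 4 * Lip_sq c.
Proof. by rewrite /Lip exprMn sqr_sqrtr ?Lip2_ge0//; ring. Qed.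

Lemma Lip_gt0 : 0 < Lip.
Proof.
rewrite mulr_gt0// sqrtr_gt0 /Lip_sq addr_gt0// divr_gt0// subr_gt0//.
Qed.

Lemma g_mx_ge0 x X : 0 <= bil (g_mx c x) X X.
Proof.
have [->|X0] := eqVneq X 0; first by rewrite /bil mulmx0 mxE.
exact/ltW/g_mx_pos.
Qed.

Lemma dx_i_sqr_le x X (i : 'I_4) : i = 0 \/ i = 1 ->
  X i 0 ^+ 2 <= Lip ^+ 2 * bil (g_mx c x) X X.
Proof.
have [X0 X1] := dx01_le hc x X; have gX := g_mx_ge0 x X; have L2 := Lip2_ge0 hc.
have H : Lip_sq c * bil (g_mx c x) X X <= Lip ^+ 2 * bil (g_mx c x) X X.
  by rewrite Lip_sqr ler_wpM2r// ler_peMl// ler1n.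
by move=> [->|->]; apply: le_trans H.
Qed.

(** Cauchy-Schwarz, by Lagrange's identity. *)
Lemma dnsq2_sqr_le x X : (dnsq2 x X / 2) ^+ 2 <= nsq2 x * (X 2 0 ^+ 2 + X 3 0 ^+ 2).
Proof.
have -> : nsq2 x * (X 2 0 ^+ 2 + X 3 0 ^+ 2) =
    (dnsq2 x X / 2) ^+ 2 + (x 2 0 * X 3 0 - x 3 0 * X 2 0) ^+ 2.
  by rewrite /dnsq2 /nsq2; field.
by rewrite lerDl sqr_ge0.
Qed.

Lemma dln_sqr_le x X : (dnsq2 x X / (1 + nsq2 x)) ^+ 2 <= Lip ^+ 2 * bil (g_mx c x) X X.
Proof.
rewrite Lip_sqr -mulrA; apply: le_trans (ler_wpM2l _ (dx23_le hc x X)); last by [].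
have -> : (dnsq2 x X / (1 + nsq2 x)) ^+ 2 = 4 * ((dnsq2 x X / 2) ^+ 2 * (h x * h x)).
  by field; exact: nsq2_neq0.
rewrite ler_wpM2l//; apply: le_trans (ler_wpM2r _ (dnsq2_sqr_le x X)) _.
  by rewrite mulr_ge0// ltW// inv_nsq2_gt0.
rewrite mulrAC ler_wpM2r ?addr_ge0 ?sqr_ge0//.
exact: nsq2_inv_sqr_le.
Qed.

(** The inverse square root of [1 + |q2|^2] is written with [expR] and [ln], to which the rules for
    derivatives and smoothness apply. *)
Lemma expR_half_sqr x : expR (- (ln (1 + nsq2 x) / 2)) ^+ 2 = h x.
Proof.
rewrite -expRM_natl mulrN mulrCA mulfV ?pnatr_eq0// mulr1 expRN lnK//.
by rewrite posrE nsq2_gt0.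
Qed.

(** The differential at [x], on the vector [X], of [x_i / sqrt (1 + |q2|^2)]. *)
Definition dscaled (i : 'I_4) x X : R :=
  (X i 0 - x i 0 * (dnsq2 x X / 2) / (1 + nsq2 x)) * expR (- (ln (1 + nsq2 x) / 2)).

(** Both terms in front of the exponential have square at most [|dq2|^2], the second because
    [|q2|^2 h <= 1]; the square of their difference is at most four times that. *)
Lemma dscaled_sqr_le i x X : i = 2 \/ i = 3 ->
  dscaled i x X ^+ 2 <= Lip ^+ 2 * bil (g_mx c x) X X.
Proof.
move=> i23; rewrite exprMn expR_half_sqr Lip_sqr -(mulrA 4).
apply: le_trans (ler_wpM2l _ (dx23_le hc x X)); last by [].
rewrite [leRHS](_ : _ = 4 * (X 2 0 ^+ 2 + X 3 0 ^+ 2) * h x); last by ring.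
rewrite ler_wpM2r//; first by rewrite ltW// inv_nsq2_gt0.
set Y := X 2 0 ^+ 2 + X 3 0 ^+ 2; have Y0 : 0 <= Y by rewrite addr_ge0 ?sqr_ge0.
have XY : X i 0 ^+ 2 <= Y.
  by case: i23 => ->; rewrite /Y ?lerDl ?lerDr sqr_ge0.
have xr : x i 0 ^+ 2 <= nsq2 x.
  by case: i23 => ->; rewrite /nsq2 ?lerDl ?lerDr sqr_ge0.
set B := x i 0 * _ / _.
have B2 : B ^+ 2 <= Y.
  have -> : B ^+ 2 = x i 0 ^+ 2 * (dnsq2 x X / 2) ^+ 2 * (h x * h x).
    by rewrite /B !exprMn; ring.
  have r0 := nsq2_ge0 x; have k0 := inv_nsq2_gt0 x.
  apply: (@le_trans _ _ (nsq2 x * (nsq2 x * Y) * (h x * h x))).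
    rewrite ler_wpM2r ?mulr_ge0 ?(ltW k0)// ler_pM ?sqr_ge0//.
    exact: dnsq2_sqr_le.
  have -> : nsq2 x * (nsq2 x * Y) * (h x * h x) = (nsq2 x * h x) ^+ 2 * Y by ring.
  rewrite -[leRHS]mul1r ler_wpM2r// exprn_ile1// ?mulr_ge0 ?(ltW k0)//.
  by rewrite ler_pdivrMr ?nsq2_gt0// mul1r lerDr.
have := sqr_ge0 (X i 0 + B).
have -> : (X i 0 - B) ^+ 2 = 2 * X i 0 ^+ 2 + 2 * B ^+ 2 - (X i 0 + B) ^+ 2 by ring.
lra.
Qed.

End LipschitzBounds.

(** * Convergence of Cauchy sequences *)

Section Completeness.
Variables (R : realType) (c : R).
Hypothesis hc : 1 < c.
Local Notation V := 'cV[R]_4.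
Local Notation VC := 'cV[R[i]]_4.
Implicit Types x X : V.

Local Notation h x := (1 + nsq2 x)^-1.
Local Open Scope classical_set_scope.

(* [x_i / sqrt (1 + |q_2|^2)]: like [ln (1 + |q_2|^2)], its differential is bounded
   for the metric, and the two functions determine [x_i]. *)
Definition scaled (i : 'I_4) x : R := x i 0 * expR (- (ln (1 + nsq2 x) / 2)).

Lemma g_mx_continuous i j : continuous (fun x => g_mx c x i j).
Proof. exact/smooth_continuous/smooth_g_mx. Qed.

Section AlongCurve.
Variable y : R -> V.
Hypothesis C1 : C1_curve y.
Local Notation y' := (derive1 y).

Lemma smooth_along (f : V -> R) : smooth f -> continuous (fun s => f (y s)).
Proof.
move=> sf s; apply: (@continuous_comp _ _ _ y f); last exact: smooth_continuous.
exact: (curve_continuous C1).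
Qed.

Lemma speed_coord_continuous i : continuous (fun s => y' s i 0).
Proof. by apply: coord_curve_continuous; case: C1. Qed.

Lemma coord_along_continuous i : continuous (fun s => y s i 0).
Proof. exact/coord_curve_continuous/curve_continuous. Qed.

Lemma dnsq2_along_continuous : continuous (fun s => dnsq2 (y s) (y' s)).
Proof.
apply: continuous_mul; first exact: cst_continuous.
by apply: continuous_add; apply: continuous_mul;
  [exact: coord_along_continuous|exact: speed_coord_continuous|
   exact: coord_along_continuous|exact: speed_coord_continuous].
Qed.

Lemma nsq2_along s : is_derive s (1 : R) (fun t => 1 + nsq2 (y t)) (dnsq2 (y s) (y' s)).
Proof.
have D i := is_derive_exp 2 (curve_is_derive s i C1).
have E := is_derive_add (is_derive_cst (1 : R) s (1 : R)) (is_derive_add (D 2) (D 3)).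
by apply: (is_derive_eq E); rewrite add0r /dnsq2 /=; ring.
Qed.

Lemma ln_along s : is_derive s (1 : R) (fun t => ln (1 + nsq2 (y t)))
  (dnsq2 (y s) (y' s) / (1 + nsq2 (y s))).
Proof.
exact: (is_derive_lnf (f := fun t => 1 + nsq2 (y t)) (nsq2_gt0 _) (nsq2_along s)).
Qed.

Lemma scaled_along i s :
  is_derive s (1 : R) (fun t => scaled i (y t)) (dscaled i (y s) (y' s)).
Proof.
have D1 := is_derive_opp (is_derive_mul (ln_along s)
  (is_derive_cst (2^-1 : R) s (1 : R))).
have D2 := is_derive_comp (is_derive_expR _) D1.
have D3 := is_derive_mul (curve_is_derive s i C1) D2.
by apply: (is_derive_eq D3); rewrite /dscaled /=; ring.
Qed.

Lemma coord_lipschitz i : i = 0 \/ i = 1 ->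
  `|y 1 i 0 - y 0 i 0| <= Lip c * curve_length (g_mx c) y.
Proof.
move=> i01; apply: (@curve_lipschitz _ _ (g_mx c) y (fun x => x i 0)
  (fun s => y' s i 0) _ g_mx_continuous C1).
- by move=> s; exact: curve_is_derive.
- exact: speed_coord_continuous.
- exact/ltW/Lip_gt0.
- by move=> s; exact: dx_i_sqr_le.
Qed.

Lemma ln_lipschitz :
  `|ln (1 + nsq2 (y 1)) - ln (1 + nsq2 (y 0))| <= Lip c * curve_length (g_mx c) y.
Proof.
apply: (@curve_lipschitz _ _ (g_mx c) y (fun x => ln (1 + nsq2 x))
  (fun s => dnsq2 (y s) (y' s) / (1 + nsq2 (y s))) _ g_mx_continuous C1).
- by move=> s; exact: ln_along.
- apply: continuous_mul; first exact: dnsq2_along_continuous.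
  exact: (smooth_along (@smooth_inv_nsq2 R)).
- exact/ltW/Lip_gt0.
- by move=> s; exact: dln_sqr_le.
Qed.

Lemma scaled_lipschitz i : i = 2 \/ i = 3 ->
  `|scaled i (y 1) - scaled i (y 0)| <= Lip c * curve_length (g_mx c) y.
Proof.
move=> i23; apply: (@curve_lipschitz _ _ (g_mx c) y (scaled i)
  (fun s => dscaled i (y s) (y' s)) _ g_mx_continuous C1).
- by move=> s; exact: scaled_along.
- have sE : smooth (fun x : V => expR (- (ln (1 + nsq2 x) / 2))) by smooth_by.
  apply: continuous_mul; last exact: (smooth_along sE).
  apply: continuous_add; first exact: speed_coord_continuous.
  have -> : (fun s => - (y s i 0 * (dnsq2 (y s) (y' s) / 2) / (1 + nsq2 (y s)))) =
      fun s => (-2^-1 * y s i 0) * (dnsq2 (y s) (y' s) * (1 + nsq2 (y s))^-1).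
    by apply/funext => s; ring.
  apply: continuous_mul.
    apply: continuous_mul; first exact: cst_continuous.
    exact: coord_along_continuous.
  apply: continuous_mul; first exact: dnsq2_along_continuous.
  exact: (smooth_along (@smooth_inv_nsq2 R)).
- exact/ltW/Lip_gt0.
- by move=> s; exact: dscaled_sqr_le.
Qed.

End AlongCurve.

Lemma dist_g_mx_le x z : riemannian_dist (g_mx c) x z <=
  4 * (`|z 0 0 - x 0 0| + `|z 1 0 - x 1 0| + `|z 2 0 - x 2 0| + `|z 3 0 - x 3 0|).
Proof.
apply: le_trans (riemannian_dist_le _ _ _) _.
apply: curve_length_segment_le; first exact: g_mx_continuous.
move=> w; set S := _ + _ + _ + _.
have S0 : 0 <= S by rewrite !addr_ge0.
have -> : 4 * S = Num.sqrt (16 * S ^+ 2).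
  have -> : 16 * S ^+ 2 = (4 * S) ^+ 2 by ring.
  by rewrite sqrtr_sqr ger0_norm// mulr_ge0.
apply: ler_wsqrtr; apply: le_trans (g_mx_le hc w _) _.
by rewrite /S !mxE.
Qed.

Lemma cauchy_real_cvg (v : nat -> R) :
  (forall e, 0 < e -> exists N, forall m k, (N <= m)%N -> (N <= k)%N ->
     `|v m - v k| < e) -> exists l : R, v @ \oo --> l.
Proof.
move=> cv; apply/cvg_ex; apply/cauchy_cvgP/cauchy_exP => e e0.
have [N vN] := cv e e0; exists (v N); exists N => // m /= Nm.
exact: vN.
Qed.

Lemma complete_g_mx : complete_metric (g_mx c).
Proof.
move=> u cu.
(* A function that is Lipschitz along curves is Lipschitz for the distance, so its values along [u]
   form a real Cauchy sequence. *)
have cvf (f : V -> R) : (forall y, C1_curve y ->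
    `|f (y 1) - f (y 0)| <= Lip c * curve_length (g_mx c) y) ->
    exists l : R, (fun m => f (u m)) @ \oo --> l.
  move=> fL; apply: cauchy_real_cvg => e e0.
  have [N uN] := cu (e / Lip c) (divr_gt0 e0 (Lip_gt0 hc)).
  exists N => m k Nm Nk.
  apply: le_lt_trans (riemannian_dist_lipschitz (u k) (u m) (Lip_gt0 hc) fL) _.
  by rewrite mulrC -ltr_pdivlMr ?Lip_gt0// uN.
have [a0 ca0] := cvf (fun x => x 0 0)
  (fun y Cy => coord_lipschitz Cy (or_introl erefl)).
have [a1 ca1] := cvf (fun x => x 1 0)
  (fun y Cy => coord_lipschitz Cy (or_intror erefl)).
have [a2 ca2] := cvf (scaled 2)
  (fun y Cy => scaled_lipschitz Cy (or_introl erefl)).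
have [a3 ca3] := cvf (scaled 3)
  (fun y Cy => scaled_lipschitz Cy (or_intror erefl)).
have [a4 ca4] := cvf (fun x => ln (1 + nsq2 x)) ln_lipschitz.
(* Convergence of the logarithm keeps [1 + |q2|^2] bounded, so the rescaling can be undone in the
   limit. *)
have cvx i (a : R) : (fun m => scaled i (u m)) @ \oo --> a ->
    (fun m => u m i 0) @ \oo --> a * expR (a4 / 2).
  move=> ca.
  have -> : (fun m => u m i 0) =
      fun m => scaled i (u m) * expR (ln (1 + nsq2 (u m)) / 2).
    by apply/funext => m; rewrite /scaled -mulrA expRNK mulr1.
  apply: cvgM => //.
  have c4 : (fun m => ln (1 + nsq2 (u m)) / 2) @ \oo --> a4 / 2.
    by apply: cvgM => //; exact: cvg_cst.
  by apply: (cvg_comp _ _ c4); exact: continuous_expR.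
pose x : V := col4 [:: a0; a1; a2 * expR (a4 / 2); a3 * expR (a4 / 2)].
exists x => e e0.
(* The 16 accounts for four coordinates and the constant 4 of [dist_g_mx_le]. *)
have cd i : (fun m => u m i 0) @ \oo --> x i 0 ->
    exists N, forall m, (N <= m)%N -> `|x i 0 - u m i 0| < e / 16.
  move=> /cvgrPdist_lt /(_ (e / 16)) [|N _ uN]; first by rewrite divr_gt0.
  by exists N => m; exact: uN.
have [N0 u0] : exists N, forall m, (N <= m)%N -> `|x 0 0 - u m 0 0| < e / 16.
  by apply: cd; rewrite mxE.
have [N1 u1] : exists N, forall m, (N <= m)%N -> `|x 1 0 - u m 1 0| < e / 16.
  by apply: cd; rewrite mxE.
have [N2 u2] : exists N, forall m, (N <= m)%N -> `|x 2 0 - u m 2 0| < e / 16.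
  by apply: cd; rewrite mxE; exact: cvx.
have [N3 u3] : exists N, forall m, (N <= m)%N -> `|x 3 0 - u m 3 0| < e / 16.
  by apply: cd; rewrite mxE; exact: cvx.
exists (maxn (maxn N0 N1) (maxn N2 N3)) => m; rewrite !geq_max.
move=> /andP[/andP[/u0 l0 /u1 l1] /andP[/u2 l2 /u3 l3]].
by apply: le_lt_trans (dist_g_mx_le _ _) _; lra.
Qed.
End Completeness.

Unset Implicit Arguments.

Theorem proposition5p6 (R : realType) (c : R) (hc : 1 < c) :
  let K := Kpot c in
  let g := metric_of (Iplus K) (Iminus K) (FL K) in
  [/\ (* K is smooth and determines the data (I_+, I_-, F) *)
      [/\ smooth K,
          diffeo (tL K),
          diffeo (sL K) &
          forall x X Y : 'cV[R]_4,
            OmegaL K x X Y = (bil (FL K x) X Y)%:C /\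
            OmegaL K x X Y = i_ddbar K x X Y],
      (forall x : 'cV[R]_4,
         d_q1 (d_q1bar (cfun K)) x = (c^-1)%:C /\
         d_q2 (d_q2bar (cfun K)) x = ((1 + nsq (q2 x))^-1)%:C),
      gk_symplectic_type (Iplus K) (Iminus K) (FL K),
      (forall x X Y : 'cV[R]_4,
         (bil (g x) X Y)%:C = metric_formula c x X Y) &
      complete_metric g].
Proof.
move=> K g; have c0 : c != 0 by rewrite gt_eqF// (lt_trans ltr01).
have gE : g = g_mx c.
  by apply/funext => x; rewrite /g FLE// IplusE// IminusE//; exact: metric_ofE.
split.
- split; [exact: smooth_Kpot|exact: diffeo_tL|exact: diffeo_sL|move=> x X Y].
  by split; [exact: OmegaL_bil|exact: OmegaL_ddbar].
- by move=> x; split; [exact: d_q1q1barK|exact: d_q2q2barK].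
- by rewrite FLE// IplusE// IminusE//; exact: gk_symplectic_data.
- by move=> x X Y; rewrite gE; exact: bil_metric_formula.
- by rewrite gE; exact: complete_g_mx.
Qed.
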